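(* Let $m\geq2$, $q_1,\dots,q_m\geq2$ and $p_1,\dots,p_m\in\mathbb{Z}$ be integers, let $T=\{f_1,\dots,f_m\}$ with $f_i(x)=\frac{x}{q_i}+\frac{p_i}{q_i}$ for $x\in\mathbb{R}$, and let $K_T\subset\mathbb{R}$ be the attractor of $T$. Let $\psi:\mathbb{N}\to\mathbb{R}_+$ be non-increasing and let $$E_{\psi,T,\mathrm{int}}=\Big\{x\in K_T:\ |x-r|\leq\psi(h_{\mathrm{int}}(r))\ \text{for infinitely many } r\in\mathbb{Q}\cap K_T\Big\}.$$ Then $$\dim_H E_{\psi,T,\mathrm{int}}=\frac{\dim_H K_T}{\max\{1,\delta_\psi\}}.$$
   Context: $\dim_H$ is Hausdorff dimension. The attractor $K_T$ is the unique non-empty compact set with $K_T=\bigcup_i f_i(K_T)$. The canonical projection $\pi:\{1,\dots,m\}^{\mathbb{N}}\to K_T$ is $\pi((j_n)_n)=\lim_{n\to+\infty}f_{j_1}\circ\cdots\circ f_{j_n}(0)$. It is known that a rational $r$ belongs to $K_T$ if and only if there are $n\ge1$, $(i_1,\dots,i_n)\in\{1,\dots,m\}^n$ and $0\leq k\leq n-1$ with $r=\pi\big((i_1,\dots,i_n,(i_{k+1},\dots,i_n)_\infty)\big)$, where $(i_{k+1},\dots,i_n)_\infty$ denotes infinite periodic repetition of the block. The intrinsic height of $r\in\mathbb{Q}\cap K_T$ is $$h_{\mathrm{int}}(r)=\min\Big\{\prod_{1\leq j\leq k}q_{i_j}\Big(\prod_{k+1\leq j\leq n}q_{i_j}-1\Big)\Big\},$$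 the minimum being over all $n$, $(i_1,\dots,i_n)$ and $0\le k\le n-1$ representing $r$ in this form. Finally $\delta_\psi=\liminf_{q\to+\infty}\frac{-\log\psi(q)}{\log q}$, with the conventions $-\log0=+\infty$ and $c/{+\infty}=0$ for $0\le c<\infty$. *)

(* Defs.v *)
From HB Require Import structures.
From mathcomp Require Import all_boot all_order all_algebra.
From mathcomp Require Import all_classical all_reals all_analysis.

Set Implicit Arguments.
Unset Strict Implicit.
Unset Printing Implicit Defensive.

Import Order.TTheory GRing.Theory Num.Theory.
Import numFieldNormedType.Exports.

Local Open Scope classical_set_scope.
Local Open Scope ring_scope.

(* Hausdorff measure and dimension of subsets of the real line *)
Section HausdorffDimension.
Context {R : realType}.
Implicit Types (A U : set R) (s d : R).
Local Open Scope ereal_scope.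

Definition diam U : \bar R := ereal_sup [set (`|x - y|%R)%:E | x in U & y in U].

(* |U|^s; the empty set gets weight 0 for every s, and a nonempty U has
   |U|^0 = 1 *)
Definition diam_pow s U : \bar R :=
  if U == set0 then 0 else poweR (diam U) s.

Definition hausdorff_premeasure s d A : \bar R :=
  ereal_inf [set \sum_(0 <= k <oo) diam_pow s (U k) | U in
    [set U : nat -> set R |
      A `<=` \bigcup_k U k /\ forall k, diam (U k) <= d%:E]].

(* The limit as d -> 0+ is a supremum, since the premeasures are nonincreasing
   in d. *)
Definition hausdorff_measure s A : \bar R :=
  ereal_sup [set hausdorff_premeasure s d A | d in [set d | (0 < d)%R]].

(* In particular the empty set has dimension 0. *)
Definition hausdorff_dim A : \bar R :=
  ereal_inf [set s%:E | s in [set s | (0 <= s)%R /\ hausdorff_measure s A = 0]].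

End HausdorffDimension.

Section IteratedFunctionSystem.
Context (R : realType) (m : nat) (q : 'I_m -> nat) (p : 'I_m -> int).

Definition ifs_map (i : 'I_m) (x : R) : R := x / (q i)%:R + (p i)%:~R / (q i)%:R.

Definition is_attractor (K : set R) : Prop :=
  [/\ K !=set0, compact K & K = \bigcup_(i in [set: 'I_m]) (ifs_map i @` K)].

(* The n-th term is f_(j 0) (f_(j 1) (... (f_(j (n-1)) 0))). *)
Definition coding_map (j : nat -> 'I_m) : R :=
  limn (fun n => foldr ifs_map 0 (mkseq j n)).

(* Words have length n.+1, so that they are nonempty, and are indexed from 0:
   for w = (w_0, ..., w_n), this is the sequence
   (w_0, ..., w_n, (w_k, ..., w_n) repeated periodically). *)
Definition word_seq n (w : n.+1.-tuple 'I_m) (k : 'I_n.+1) : nat -> 'I_m :=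
  fun t => tnth w (inord (if (t < n.+1)%N then t
                          else (k + (t - n.+1) %% (n.+1 - k))%N)).

Definition word_height n (w : n.+1.-tuple 'I_m) (k : 'I_n.+1) : nat :=
  ((\prod_(j < n.+1 | j < k) q (tnth w j)) *
   ((\prod_(j < n.+1 | k <= j) q (tnth w j)) - 1))%N.

Definition heights (r : rat) : set nat :=
  [set h | exists n (w : n.+1.-tuple 'I_m) (k : 'I_n.+1),
     ratr r = coding_map (word_seq w k) /\ h = word_height w k].

(* The minimum of heights r. The default value 0 is taken only if heights r is
   empty, that is, if r is not in the attractor. *)
Definition h_int (r : rat) : nat :=
  xget 0%N [set h | heights r h /\ forall h', heights r h' -> (h <= h')%N].

Definition E_int (K : set R) (psi : nat -> R) : set R :=
  [set x | K x /\
     infinite_set [set r : rat | K (ratr r) /\ `|x - ratr r| <= psi (h_int r)]].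

End IteratedFunctionSystem.

(* lne 0 = -oo; the terms of index 0 and 1 do not affect the lower limit. *)
Definition delta_exp {R : realType} (psi : nat -> R) : \bar R :=
  limn_einf (fun n => (- lne (psi n)%:E / lne (n%:R)%:E)%E).

(* Main.v *)
Require Import Defs.
From mathcomp Require Import all_boot all_order all_algebra.
From mathcomp Require Import all_classical all_reals all_analysis.
From mathcomp Require Import ring lra zify.
Import Order.TTheory GRing.Theory Num.Theory.
Import numFieldNormedType.Exports.
Set Implicit Arguments.
Unset Strict Implicit.
Unset Printing Implicit Defensive.
Local Open Scope classical_set_scope.
Local Open Scope ring_scope.

(** The composition of the [f_i] along a word [w] is again of the same shape,
    [x |-> (x + P_w) / Q_w], with [Q_w] the product of the [q_i] and [P_w] an
    integer, called here the digit of [w]. For a fixed [Q] all the maps with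
    [Q_w = Q] are translates of each other by multiples of [1/Q], so distinct ones
    are separated by [1/Q] automatically. This integrality replaces any
    separation condition, and everything is governed by the number [D(Q)] of
    distinct digits of words with [Q_w = Q].

    - If [D(Q) > (2B+1) Q^s] for one [Q], where [B] bounds [K], a residue class
      modulo [2B+1] contains more than [Q^s] digits. Digits in one class are so far
      apart that expansions in base [Q] with these digits form a self-similar
      Cantor set inside [K] with disjoint pieces, hence
      [dim K >= s] ([well_spaced_subsystem], [hausdorff_dim_digit_set]).
    - Hence for [s0 > dim K] one has [D(Q) <= (2B+1) Q^s0] for every [Q]. There
      are few possible values of [Q], since [Q_w] depends only on how often each
      letter occurs in [w]; an Euler product shows that the sum of [Q^-s] over
      all distinct maps converges for every [s > s0] ([sum_maps_le]). Since [K] is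
      covered infinitely often by its images, this gives [dim K <= s] whenever
      the bound holds with exponent [s0 < s], so that [dim K] is exactly the
      growth exponent of [D].

    Upper bound. If [max(1, delta) = 1] it follows from [E] being a subset of [K].
    A rational of [K] with preperiod [u] and period [v] is determined by the maps
    of [u] and [v] and has height [Q_u (Q_v - 1) >= Q_u Q_v / 2]. The sum of
    [h_int(r)^-s] over the rationals of [K] is thus at most the square of the
    previous one, up to a constant ([sum_h_int_le]), and
    [psi(h) <= C h^-sigma] with [sigma < delta] makes the natural cover of [E]
    summable with exponent [s / sigma] ([E_int_dim_le]).

    Lower bound. Let [s < dim K] and [tau > max(1, delta)]. Some [Q] has more
    than [Q^s] well-spaced digits, and [psi(n) > n^-tau] for infinitely many [n].
    For a very sparse sequence of such [n], with [Q^k] close to [n], force all the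
    digits between positions [k] and about [tau k] to be one fixed digit, ending
    with one different digit, and leave the others free. A point of the resulting Cantor set is within
    [n^-tau] of the rational obtained by repeating that digit for ever, whose
    height is at most [n]; and the proportion of free positions up to
    any given one is at least about [1 / tau], so that the dimension is at least
    [s / tau] ([block_exists], [free_count_block], [E_int_dim_ge]). *)

(** * Words and the maps they compose *)

Section Words.
Context (m : nat) (q : 'I_m -> nat) (p : 'I_m -> int).

Definition wq (w : seq 'I_m) : nat := (\prod_(i <- w) q i)%N.

(** The numerator of the translation part: the digit attached to [w]. *)
Fixpoint wp (w : seq 'I_m) : int :=
  if w is i :: w' then wp w' + (wq w')%:Z * p i else 0.

(** Over a general field, because the same maps act on [rat] and on [R]. *)
Definition wmap (F : numFieldType) (w : seq 'I_m) (x : F) : F :=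
  (x + (wp w)%:~R) / (wq w)%:R.

Lemma wq_cons i w : wq (i :: w) = (q i * wq w)%N.
Proof. by rewrite /wq big_cons. Qed.

Lemma wq_cat u v : wq (u ++ v) = (wq u * wq v)%N.
Proof. by rewrite /wq big_cat. Qed.

Context (hq : forall i, (2 <= q i)%N).

Lemma wq_ge2X w : (2 ^ size w <= wq w)%N.
Proof.
elim: w => [|i w IH]; first by rewrite /wq big_nil.
by rewrite wq_cons expnS leq_mul.
Qed.

Lemma wq_gt0 w : (0 < wq w)%N.
Proof. by apply: leq_trans (wq_ge2X w); rewrite expn_gt0. Qed.

Lemma wqr_neq0 (F : numFieldType) w : (wq w)%:R != 0 :> F.
Proof. by rewrite pnatr_eq0 -lt0n wq_gt0. Qed.

Lemma wmap_nil (F : numFieldType) (x : F) : wmap [::] x = x.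
Proof. by rewrite /wmap /wq big_nil addr0 divr1. Qed.

Lemma wmap_cons (F : numFieldType) i w (x : F) :
  wmap (i :: w) x = wmap w x / (q i)%:R + (p i)%:~R / (q i)%:R.
Proof.
rewrite /wmap wq_cons /= natrM rmorphD rmorphM /=.
have h1 := wqr_neq0 F w.
have h2 : (q i)%:R != 0 :> F.
  by rewrite pnatr_eq0 -lt0n; apply: leq_trans (hq i).
by field; rewrite h1 h2.
Qed.

Lemma wmap_cat (F : numFieldType) u v (x : F) :
  wmap (u ++ v) x = wmap u (wmap v x).
Proof. by elim: u => [|i u IH]; rewrite ?wmap_nil //= !wmap_cons IH. Qed.

Lemma wmapB (F : numFieldType) w (x y : F) :
  wmap w x - wmap w y = (x - y) / (wq w)%:R.
Proof. by rewrite /wmap -mulrBl; congr (_ / _); ring. Qed.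

Definition wfix (F : numFieldType) (w : seq 'I_m) : F :=
  (wp w)%:~R / (wq w - 1)%:R.

Lemma wfixP (F : numFieldType) w (x : F) : w != [::] ->
  (wmap w x = x) <-> (x = wfix F w).
Proof.
move=> w0.
have w2 : (2 <= wq w)%N.
  apply: leq_trans (wq_ge2X w); rewrite -{1}(expn1 2) leq_exp2l //.
  by case: w w0.
rewrite /wfix /wmap natrB; last exact: ltnW.
have h1 := wqr_neq0 F w.
have h2 : (wq w)%:R - 1%:R != 0 :> F.
  by rewrite subr_eq0 eqr_nat; case: (wq w) w2 => [|[]].
split => [/(canRL (mulfVK h1)) h|->].
  apply: (mulIf h2); rewrite divfK // mulrBr -h; ring.
by field; rewrite h1 h2.
Qed.

Lemma ratr_wmap (F : numFieldType) w (x : rat) :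
  ratr (wmap w x) = wmap w (ratr x) :> F.
Proof. by rewrite /wmap fmorph_div rmorphD /= ratr_int ratr_nat. Qed.

Lemma ratr_wfix (F : numFieldType) w : ratr (wfix rat w) = wfix F w.
Proof. by rewrite /wfix fmorph_div /= ratr_int ratr_nat. Qed.

(** The hypothesis says that [[-B, B]] is stable under each [f_i]; the conclusion
    is the same statement for the composed map. *)
Lemma wp_bound (B : nat) w : (forall i, `|p i| <= B%:Z * ((q i)%:Z - 1)) ->
  `|wp w| <= B%:Z * ((wq w)%:Z - 1).
Proof.
move=> hB; elim: w => [|i w IH]; first by rewrite /= /wq big_nil normr0 subrr mulr0.
rewrite /= wq_cons PoszM (le_trans (ler_normD _ _)) // normrM ger0_norm //.
have : (wq w)%:Z * `|p i| <= (wq w)%:Z * (B%:Z * ((q i)%:Z - 1)).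
  by rewrite ler_wpM2l.
lia.
Qed.

End Words.

(** * Codings of points *)

Section Coding.
Context (R : realType) (m : nat) (q : 'I_m -> nat) (p : 'I_m -> int).
Context (hq : forall i, (2 <= q i)%N).
Local Notation f := (@ifs_map R m q p).

Lemma foldr_wmap w x : foldr f x w = wmap q p w x.
Proof.
by elim: w => [|i w IH]; rewrite /= ?wmap_nil ?(wmap_cons _ hq) // IH.
Qed.

Lemma orbit_wmap (j : nat -> 'I_m) (z : nat -> R) :
  (forall n, z n = f (j n) (z n.+1)) ->
  forall n, z 0%N = wmap q p (mkseq j n) (z n).
Proof.
move=> zE n; rewrite -foldr_wmap; elim: n => [|n IH] //.
by rewrite mkseqS foldr_rcons -zE.
Qed.

Lemma cvg_div2X (M : R) : (fun n : nat => M / 2 ^+ n) @ \oo --> (0 : R).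
Proof.
have := @cvg_geometric R M (2^-1).
rewrite ger0_norm ?invr_ge0// invf_lt1 ?ltr1n// => /(_ isT).
apply: cvg_trans; apply: near_eq_cvg; apply: nearW => n /=.
by rewrite /geometric /= exprVn.
Qed.

Lemma wmap_dist (w : seq 'I_m) (x y M : R) : `|x - y| <= M ->
  `|wmap q p w x - wmap q p w y| <= M / 2 ^+ size w.
Proof.
move=> xyM; rewrite wmapB // normrM normfV [`|_%:R|]ger0_norm ?ler0n//.
have M0 : 0 <= M := le_trans (normr_ge0 _) xyM.
apply: ler_pM => //.
rewrite lef_pV2 ?posrE ?ltr0n ?exprn_gt0 ?wq_gt0 //.
by rewrite -natrX ler_nat wq_ge2X.
Qed.

(** The contractions forget the bounded tail, so any bounded backward orbit along
    [j] starts at the coding of [j]. *)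
Lemma coding_orbit (j : nat -> 'I_m) (z : nat -> R) (M : R) :
  (forall n, `|z n| <= M) -> (forall n, z n = f (j n) (z n.+1)) ->
  coding_map R q p j = z 0%N.
Proof.
move=> zM zE; apply/cvg_lim => //.
apply/cvgrPdist_le => e e0.
have := cvg_div2X M => /cvgrPdist_le /(_ _ e0); apply: filterS => n.
rewrite sub0r normrN => h; rewrite (orbit_wmap zE n) foldr_wmap.
apply: le_trans (le_trans (ler_norm _) h).
by rewrite -[in leRHS](size_mkseq j n); apply: wmap_dist; rewrite subr0.
Qed.

Context (B : nat).
Context (hB : forall i, `|p i| <= B%:Z * ((q i)%:Z - 1)).

Lemma q_gt0 i : 0 < (q i)%:R :> R.
Proof. by rewrite ltr0n; apply: leq_trans (hq i). Qed.

Lemma ifs_map_bound i (x : R) : `|x| <= B%:R -> `|f i x| <= B%:R.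
Proof.
move=> xB; rewrite /ifs_map -mulrDl normrM normfV [`|(q i)%:R|]ger0_norm ?ler0n //.
rewrite ler_pdivrMr ?q_gt0 // (le_trans (ler_normD _ _)) //.
have := hB i; rewrite -(ler_int R) rmorphM rmorphB /= intr_norm => h.
by move: h; rewrite mulrBr mulr1; lra.
Qed.

Lemma wmap0_bound w : `|wmap q p w (0 : R)| <= B%:R.
Proof.
rewrite -foldr_wmap; elim: w => [|i w IH] /=; first by rewrite normr0.
exact: ifs_map_bound.
Qed.

Lemma coding_cvg (j : nat -> 'I_m) :
  cvgn (fun n => foldr f 0 (mkseq j n)).
Proof.
pose u n := foldr f 0 (mkseq j n).
suff : cvgn (series (telescope u)).
  rewrite telescopeK => h.
  have -> : (fun n => foldr f 0 (mkseq j n)) = (fun n => (u n - u 0%N) + u 0%N).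
    by apply/funext => n; rewrite subrK.
  by apply: is_cvgD => //; apply: is_cvg_cst.
apply: normed_cvg.
apply: (@series_le_cvg _ _ (geometric B%:R 2^-1)) => [n|n|n|] /=.
- exact: normr_ge0.
- by rewrite mulr_ge0 // exprn_ge0 // invr_ge0.
- rewrite (_ : telescope u n = u n.+1 - u n) // /u mkseqS foldr_rcons !foldr_wmap exprVn.
  rewrite -[in leRHS](size_mkseq j n); apply: wmap_dist; rewrite subr0.
  by apply: ifs_map_bound; rewrite normr0.
- apply: is_cvg_geometric_series.
  by rewrite ger0_norm ?invr_ge0// invf_lt1 ?ltr1n.
Qed.

Lemma coding_bound (j : nat -> 'I_m) : `|coding_map R q p j : R| <= B%:R.
Proof.
have h := coding_cvg (j:=j).
rewrite ler_norml; apply/andP; split.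
  apply: limr_ge h _; apply: nearW => n; rewrite foldr_wmap.
  by have := wmap0_bound (mkseq j n); rewrite ler_norml => /andP[].
apply: limr_le h _; apply: nearW => n; rewrite foldr_wmap.
by have := wmap0_bound (mkseq j n); rewrite ler_norml => /andP[].
Qed.

Lemma codingS (j : nat -> 'I_m) :
  coding_map R q p j = f (j 0%N) (coding_map R q p (j \o succn)).
Proof.
have h := coding_cvg (j:=j \o succn).
apply/cvg_lim => //; rewrite -cvg_shiftS /=.
have -> : (fun n => foldr f 0 (mkseq j n.+1)) =
    (fun n => f (j 0%N) (foldr f 0 (mkseq (j \o succn) n))).
  apply/funext => n; rewrite /mkseq /= -[1%N]addn0 iotaDl -map_comp.
  by [].
rewrite /ifs_map; apply: cvgD; last exact: cvg_cst.
by apply: cvgM => //; exact: cvg_cst.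
Qed.

Lemma coding_shift (j : nat -> 'I_m) n :
  coding_map R q p j = wmap q p (mkseq j n) (coding_map R q p (fun t => j (n + t)%N)) :> R.
Proof.
pose z k : R := coding_map R q p (fun t => j (k + t)%N).
have zE k : z k = f (j k) (z k.+1).
  rewrite /z codingS addn0; congr (f _ (coding_map R _ _ _)).
  by apply/funext => t /=; rewrite addnS addSn.
by rewrite -(orbit_wmap zE n).
Qed.

End Coding.

(** * The attractor and its rational points *)

Section Attractor.
Context (R : realType) (m : nat) (q : 'I_m -> nat) (p : 'I_m -> int).
Context (K : set R).
Context (hq : forall i, (2 <= q i)%N).
Context (hK : is_attractor q p K).
Local Notation f := (@ifs_map R m q p).

Lemma attractor_wmap w x : K x -> K (wmap q p w x).
Proof.
have [_ _ KE] := hK; move=> Kx; rewrite -foldr_wmap //.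
by elim: w => //= i w IH; rewrite KE; exists i => //; exists (foldr f x w).
Qed.

Lemma attractor_bounded : exists M : R, forall x, K x -> `|x| <= M.
Proof.
have [_ /compact_bounded [M [_ hM]] _] := hK.
by exists (M + 1) => x Kx; apply: (hM (M + 1)) => //; rewrite ltrDl.
Qed.

Lemma attractor_limit x :
  (forall e, 0 < e -> exists2 y, K y & `|x - y| <= e) -> K x.
Proof.
have [_ cK _] := hK; move=> h.
apply: (compact_closed (@Rhausdorff R) cK) => A.
rewrite -nbhs_ballE => -[e /= e0 eA].
have [|y Ky xy] := h (e / 2); first exact: divr_gt0.
exists y; split => //; apply: eA; rewrite /ball /=.
by apply: le_lt_trans xy _; rewrite ltr_pdivrMr // ltr_pMr // ltr1n.
Qed.

Lemma attractor_orbit x : K x -> exists (j : nat -> 'I_m) (z : nat -> R),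
  [/\ z 0%N = x, forall n, K (z n) & forall n, z n = f (j n) (z n.+1)].
Proof.
have [_ _ KE] := hK; move=> Kx.
have step y : K y -> exists iy : 'I_m * R, K iy.2 /\ y = f iy.1 iy.2.
  by move=> Ky; have := Ky; rewrite {1}KE => -[i _ [y' Ky' <-]]; exists (i, y').
have [iy0 _] := step x Kx.
have /choice [F FP] : forall y, exists iy : 'I_m * R, K y -> K iy.2 /\ y = f iy.1 iy.2.
  move=> y; have [Ky|nKy] := pselect (K y); last by exists iy0.
  by have [iy iyP] := step y Ky; exists iy.
pose z n := iter n (fun y => (F y).2) x.
have Kz n : K (z n) by elim: n => //= n /FP[].
exists (fun n => (F (z n)).1), z; split=> // n.
by have [_ {1}->] := FP _ (Kz n).
Qed.

(** A periodic tail codes the fixed point of its period: the images of that fixed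
    point under the suffixes of the word form a bounded orbit. *)
Lemma word_seq_coding n (w : n.+1.-tuple 'I_m) (k : 'I_n.+1) :
  coding_map R q p (word_seq w k) =
    wmap q p (take k w) (wfix q p R (drop k w)).
Proof.
pose c : R := wfix q p R (drop k w).
have cP : wmap q p (drop k w) c = c.
  by apply/wfixP => //; rewrite -size_eq0 size_drop size_tuple subn_eq0 -ltnNge.
(* The letter read at time [t] is the letter of the finite word at [idx t]. *)
pose idx t := if (t < n.+1)%N then t else (k + (t - n.+1) %% (n.+1 - k))%N.
have kn : (k <= n)%N by rewrite -ltnS.
have idxlt t : (idx t < n.+1)%N.
  rewrite /idx; case: (ltnP t) => // _.
  have : ((t - n.+1) %% (n.+1 - k) < n.+1 - k)%N by rewrite ltn_mod; lia.
  by move: (_ %% _)%N => r; rewrite ltn_subRL.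
have idxS t : idx t.+1 = if (idx t < n)%N then (idx t).+1 else k.
  rewrite /idx ltnS; case: (ltngtP t n) => [tn|tn|->].
  - by rewrite !ltnS (ltnW tn) tn.
  - rewrite !ltnS (leqNgt t n) tn /=.
    have -> : (t.+1 - n.+1 = (t - n.+1) + 1)%N by rewrite addn1 subSn.
    rewrite -modnDml; set d := (n.+1 - k)%N; set s := ((t - n.+1) %% d)%N.
    have sd : (s < d)%N by rewrite ltn_mod /d; lia.
    case: (ltnP (k + s) n) => ks.
      by rewrite modn_small ?addn1 ?addnS // /d; lia.
    by rewrite (_ : (s + 1)%N = d) ?modnn ?addn0 // /d in sd *; lia.
  - by rewrite ltnSn ltnn subnn mod0n addn0.
pose z t := wmap q p (drop (idx t) w) c.
have zE t : z t = f (word_seq w k t) (z t.+1).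
  rewrite /z (drop_nth (tnth w ord0)) ?size_tuple // wmap_cons // /ifs_map.
  have -> : word_seq w k t = nth (tnth w ord0) w (idx t).
    by rewrite /word_seq -/(idx t) (tnth_nth (tnth w ord0)) inordK.
  congr (_ / _ + _); rewrite idxS.
  case: ltnP => // h.
  by rewrite drop_oversize ?size_tuple ?wmap_nil ?cP.
pose M := \sum_(i < n.+1) `|wmap q p (drop i w) c|.
have zM t : `|z t| <= M.
  rewrite /M (bigD1 (Ordinal (idxlt t))) //= lerDl.
  by apply: sumr_ge0 => i _.
rewrite (coding_orbit hq zM zE) /z /idx /= drop0 -{1}(cat_take_drop k w).
by rewrite wmap_cat // cP.
Qed.

Lemma word_heightE n (w : n.+1.-tuple 'I_m) (k : 'I_n.+1) :
  word_height q w k = (wq q (take k w) * (wq q (drop k w) - 1))%N.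
Proof.
rewrite /word_height; congr (_ * (_ - 1))%N.
  rewrite /wq (big_nth (tnth w ord0)) size_takel ?size_tuple; last exact: ltnW.
  rewrite big_mkord (big_ord_widen n.+1 (fun i => q (nth (tnth w ord0) (take k w) i))).
    by apply: eq_bigr => i ik; rewrite nth_take // (tnth_nth (tnth w ord0)).
  exact: ltnW.
rewrite /wq (big_nth (tnth w ord0)) size_drop size_tuple.
transitivity (\prod_(j < n.+1 | (k <= j)%N) q (nth (tnth w ord0) w j))%N.
  by apply: eq_bigr => j _; rewrite (tnth_nth (tnth w ord0)).
rewrite -(big_geq_mkord k n.+1 xpredT (fun j => q (nth (tnth w ord0) w j))).
rewrite -{1}[k : nat]add0n big_addn.
by apply: eq_bigr => i _; rewrite nth_drop addnC.
Qed.

(** Along a backward orbit in [K] the denominator of a rational never grows,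
    because [f_i^-1 x = q_i x - p_i]. The orbit stays bounded, so it takes
    finitely many values, and a repetition gives a periodic coding. *)
Lemma heights_nonempty (r : rat) : K (ratr r) -> heights R q p r !=set0.
Proof.
move=> Kr; have [j [z [z0 Kz zE]]] := attractor_orbit Kr.
have [M hM] := attractor_bounded.
pose D := denq r; have D0 : 0 < D := denq_gt0 r.
have DR0 : 0 < D%:~R :> R by rewrite ltr0z.
have zint t : exists N : int, z t * D%:~R = N%:~R.
  elim: t => [|t [N IH]].
    exists (numq r); rewrite z0 -[D%:~R]ratr_int -rmorphM /= -{1}[r]divq_num_den.
    by rewrite divfK ?ratr_int // intr_eq0 denq_neq0.
  exists (N * (q (j t))%:Z - p (j t) * D).
  rewrite rmorphB !rmorphM /= -IH [z t]zE /ifs_map.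
  have h2 := q_gt0 R hq (j t).
  by field; rewrite gt_eqF.
have /choice [N NE] := zint.
pose X := Num.bound `|M * D%:~R|.
have NX t : `|N t| <= X%:Z.
  rewrite -(ler_int R) intr_norm -NE normrM [`|D%:~R|]gtr0_norm //.
  apply: (@le_trans _ _ (M * D%:~R)); first by rewrite ler_wpM2r ?hM // ltW.
  by apply: ltW; apply: le_lt_trans (ler_norm _) (archi_boundP _).
pose g (t : 'I_(X.*2.+2)) : 'I_(X.*2.+1) := inord (absz (N t + X%:Z)).
have gE (t : 'I_(X.*2.+2)) : (g t)%:Z = N t + X%:Z.
  rewrite /g inordK; last by have := NX t; lia.
  by rewrite gez0_abs //; have := NX t; lia.
have /injectivePn[a [b ab gab]] : ~~ injectiveb g.
  apply/injectiveP => /leq_card; rewrite !card_ord; lia.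
have {gab} Nab : N a = N b by have := gE a; have := gE b; rewrite gab; lia.
wlog ltab : a b ab Nab / (a < b)%N.
  move=> W; case: (ltngtP a b) => h; [exact: (W a b)| |].
    by apply: (W b a) => //; rewrite eq_sym.
  by move: ab; rewrite (val_inj h) eqxx.
have zab : z a = z b by apply: (mulIf (lt0r_neq0 DR0)); rewrite !NE Nab.
case: (b : nat) ltab zab => // n an zan.
pose w : n.+1.-tuple 'I_m := Tuple (introT eqP (size_mkseq j n.+1)).
pose k := Ordinal an.
exists (word_height q w k), n, w, k; split => //.
rewrite word_seq_coding.
have -> : take k w = mkseq j a.
  by rewrite /= /mkseq -map_take take_iota (minn_idPl _) // ltnW.
have dE : drop k w = mkseq (fun t => j (a + t)%N) (n.+1 - a).
  by rewrite /= /mkseq -map_drop drop_iota addnC iotaDl -map_comp.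
have <- : z a = wfix q p R (drop k w).
  apply/wfixP => //; first by rewrite -size_eq0 dE size_mkseq subn_eq0 -ltnNge.
  rewrite dE; have := orbit_wmap hq (p := p) (j := fun t => j (a + t)%N) (z := fun t => z (a + t)%N).
  move=> /(_ _ (n.+1 - a)%N); rewrite addn0 subnKC -?zan; last exact: ltnW.
  by move=> <- // t; rewrite addnS.
by rewrite -z0; exact: orbit_wmap.
Qed.

End Attractor.

(** * Hausdorff dimension: covers by limsup sets *)

Section HausdorffCantelli.
Context (R : realType).
Implicit Types (A U : set R) (s : R).

Lemma diam_pow_ge0 s U : (0 <= diam_pow s U)%E.
Proof. by rewrite /diam_pow; case: ifP => // _; exact: poweR_ge0. Qed.

Lemma dist_le_diam U x y : U x -> U y -> (`|x - y|%:E <= diam U)%E.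
Proof. by move=> Ux Uy; apply: ereal_sup_ubound; exists x => //; exists y. Qed.

Lemma diam_le U (d : R) : (forall x y, U x -> U y -> `|x - y| <= d) ->
  (diam U <= d%:E)%E.
Proof.
by move=> h; apply: ge_ereal_sup => _ [x Ux [y Uy <-]]; rewrite lee_fin h.
Qed.

Lemma diam_pow_le s U (d : R) : 0 < s -> 0 <= d ->
  (forall x y, U x -> U y -> `|x - y| <= d) -> (diam_pow s U <= (d `^ s)%:E)%E.
Proof.
move=> s0 d0 h; rewrite /diam_pow; case: ifPn => [_|/set0P[x Ux]].
  by rewrite lee_fin powR_ge0.
rewrite -poweR_EFin; apply: gt0_ler_poweR; rewrite ?(ltW s0) //.
- by rewrite in_itv /= leey andbT; apply: le_trans (dist_le_diam Ux Ux); rewrite lee_fin.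
- by rewrite in_itv /= leey andbT lee_fin.
- exact: diam_le.
Qed.

Lemma hausdorff_premeasure_ge0 s (d : R) A :
  (0 <= hausdorff_premeasure s d A)%E.
Proof.
apply: le_ereal_inf_tmp => _ [U _ <-].
by apply: nneseries_ge0 => k _ _; exact: diam_pow_ge0.
Qed.

Lemma hausdorff_dim_ge0 A : (0 <= hausdorff_dim A)%E.
Proof. by apply: le_ereal_inf_tmp => _ [s [s0 _] <-]; rewrite lee_fin. Qed.

Lemma hausdorff_dim_le s A : 0 <= s -> hausdorff_measure s A = 0%E ->
  (hausdorff_dim A <= s%:E)%E.
Proof. by move=> s0 h; apply: ereal_inf_lbound; exists s. Qed.

Lemma hausdorff_measureS s A A' : A `<=` A' ->
  hausdorff_measure s A' = 0%E -> hausdorff_measure s A = 0%E.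
Proof.
move=> AA' h; apply/eqP; rewrite eq_le; apply/andP; split; last first.
  apply: le_trans (hausdorff_premeasure_ge0 s 1 A) _.
  by apply: ereal_sup_ubound; exists 1 => //=.
rewrite -h; apply: ge_ereal_sup => _ [d d0 <-].
apply: le_trans (_ : hausdorff_premeasure s d A' <= _)%E; last first.
  by apply: ereal_sup_ubound; exists d.
apply: ereal_inf_le_tmp => _ [U [UA Ud] <-].
by exists U => //; split => //; apply: subset_trans UA.
Qed.

Lemma hausdorff_dimS A A' : A `<=` A' -> (hausdorff_dim A <= hausdorff_dim A')%E.
Proof.
move=> AA'; apply: le_ereal_inf_tmp => _ [s [s0 h] <-].
by apply: hausdorff_dim_le => //; exact: hausdorff_measureS h.
Qed.

(** The Hausdorff version of the Borel-Cantelli lemma: the tails of a summable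
    family still cover a set each of whose points is covered infinitely often. *)
Lemma hausdorff_cantelli (T : countType) (V : T -> set R) (rho : T -> R)
    (s Z : R) A :
  0 < s -> (forall i, 0 <= rho i) ->
  (forall i x y, V i x -> V i y -> `|x - y| <= rho i) ->
  (forall F : seq T, uniq F -> \sum_(i <- F) rho i `^ s <= Z) ->
  (forall x, A x -> infinite_set [set i | V i x]) ->
  hausdorff_measure s A = 0%E.
Proof.
move=> s0 rho0 Vrho sumZ limsup.
pose u k : R := if pickle_inv k is Some i then rho i `^ s else 0.
have u0 k : 0 <= u k by rewrite /u; case: pickle_inv => // i; exact: powR_ge0.
have uZ : (\sum_(0 <= k <oo) (u k)%:E < +oo)%E.
  apply: le_lt_trans (ltry Z).
  apply: lime_le; first by apply: is_cvg_nneseries => k _ _; rewrite lee_fin.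
  apply: nearW => n; rewrite sumEFin lee_fin.
  have -> : \sum_(0 <= k < n) u k =
      \sum_(i <- pmap (@pickle_inv T) (index_iota 0 n)) rho i `^ s.
    by rewrite big_pmap; apply: eq_bigr => k _; rewrite /u; case: pickle_inv.
  by apply: sumZ; apply: (pmap_uniq (@pickle_invK T)); exact: iota_uniq.
have tail (e : R) : 0 < e -> exists n, (\sum_(n <= k <oo) (u k)%:E < e%:E)%E.
  move=> e0.
  have tc : (\sum_(n <= k <oo) (u k)%:E)%E @[n --> \oo] --> (0%:E : \bar R).
    by apply: nneseries_tail_cvg => // k _; rewrite lee_fin.
  have [fin] := iffLR (fine_cvgP _ _) tc.
  move=> /cvgrPdist_lt /(_ _ e0) [n1 _ h1].
  case: fin => n2 _ h2; exists (maxn n1 n2).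
  have f2 := h2 _ (leq_maxr n1 n2).
  have := h1 _ (leq_maxl n1 n2); rewrite /= sub0r normrN => h.
  rewrite -(fineK f2) lte_fin; exact: le_lt_trans (ler_norm _) h.
apply/eqP; rewrite eq_le; apply/andP; split; last first.
  apply: le_trans (hausdorff_premeasure_ge0 s 1 A) _.
  by apply: ereal_sup_ubound; exists 1 => //=.
apply: ge_ereal_sup => _ [d /= d0 <-]; apply/lee_addgt0Pr => e e0; rewrite add0e.
have [n hn] : exists n, (\sum_(n <= k <oo) (u k)%:E < (Num.min e (d `^ s))%:E)%E.
  by apply: tail; rewrite lt_min e0 powR_gt0.
pose U k := if @pickle_inv T (k + n)%N is Some i then V i else set0.
(* A single term of a small tail is small, so the tail consists of small sets. *)
have ultd k : (n <= k)%N -> u k <= d `^ s.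
  move=> nk; rewrite -lee_fin; apply: le_trans (_ : _ <= (Num.min e (d `^ s))%:E)%E _.
    apply: le_trans (ltW hn).
    apply: le_trans (nneseries_lim_ge k.+1 _) => [|i _ _]; last by rewrite lee_fin.
    rewrite big_nat_recr //= leeDr //.
    by apply: sume_ge0 => i _; rewrite lee_fin.
  by rewrite lee_fin ge_min lexx orbT.
apply: le_trans (_ : (\sum_(n <= k <oo) (u k)%:E <= _)%E); last first.
  by apply: le_trans (ltW hn) _; rewrite lee_fin ge_min lexx.
apply: le_trans (_ : (\sum_(0 <= k <oo) diam_pow s (U k) <= _)%E).
  apply: ereal_inf_lbound; exists U => //; split => [x Ax|k].
  - have [i [Vi ni]] : exists i, V i x /\ (n <= pickle i)%N.
      apply: contrapT => nex; apply: (limsup x Ax).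
      apply: (@sub_finite_set _ _ (@pickle T @^-1` `I_n)).
        move=> i /= Vi; rewrite ltnNge; apply/negP => ni; apply: nex.
        by exists i.
      apply: finite_preimage; last exact: finite_II.
      by move=> a b _ _ ab; apply: (pcan_inj (@pickleK_inv T)).
    by exists (pickle i - n)%N => //; rewrite /U subnK // pickleK_inv.
  - rewrite /U; case E : (pickle_inv _) => [i|]; last first.
      by apply: diam_le.
    apply: diam_le => x y Vx Vy; apply: le_trans (Vrho i _ _ Vx Vy) _.
    rewrite leNgt; apply/negP => drho.
    have := ultd (k + n)%N (leq_addl _ _); rewrite /u E leNgt => /negP; apply.
    by apply: gt0_ltr_powR => //; rewrite nnegrE ?rho0 ?ltW.
rewrite -(@nneseries_addn R (fun k => (u k)%:E) n); last by move=> i; rewrite lee_fin.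
apply: lee_nneseries => k _ /=; first by move=> _; exact: diam_pow_ge0.
rewrite /U /u; case: pickle_inv => [i|].
  by apply: diam_pow_le => //; exact: Vrho.
by rewrite /diam_pow eqxx.
Qed.

End HausdorffCantelli.

(** * A product measure without measure theory *)

Section Avoidance.
Context (R : realType) (N : nat) (c : nat -> option 'I_N).

Definition free_count (l : nat) : nat := (\sum_(0 <= k < l) (c k == None))%N.

(** [c n] is the letter imposed at position [n], and [None] marks a free
    position. *)
Definition admissible (j : nat -> 'I_N) := forall n d, c n = Some d -> j n = d.

Lemma free_countS l : free_count l.+1 = (free_count l + (c l == None))%N.
Proof. by rewrite /free_count big_nat_recr. Qed.

Lemma leq_free_count : {homo free_count : a b / (a <= b)%N}.
Proof.
move=> a b ab; rewrite /free_count (big_cat_nat (leq0n a) ab) /=.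
exact: leq_addr.
Qed.

(** Conditional probability of the cylinder [u] given the cylinder [x], when the
    letters in the free positions are independent and uniform. *)
Definition cond_weight (x u : seq 'I_N) : R :=
  if take (size u) x == take (size x) u
  then N%:R ^- (free_count (size u) - free_count (size x)) else 0.

Lemma cond_weight_ge0 x u : 0 <= cond_weight x u.
Proof. by rewrite /cond_weight; case: ifP => // _; rewrite invr_ge0 exprn_ge0. Qed.

Lemma compatible_rcons (x u : seq 'I_N) d :
  take (size u) (rcons x d) = take (size (rcons x d)) u ->
  take (size u) x = take (size x) u.
Proof.
rewrite size_rcons => /(congr1 (take (size x))).
rewrite -!take_min minnC (minn_idPl (leqnSn _)) take_min.
by rewrite -cats1 take_size_cat.
Qed.

Lemma compatible_nth (x u : seq 'I_N) d : (size x < size u)%N ->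
  take (size u) (rcons x d) = take (size (rcons x d)) u ->
  d = nth d u (size x).
Proof.
move=> xu; rewrite take_oversize ?size_rcons // => h.
by rewrite -(nth_take d (n0 := (size x).+1)) // -h nth_rcons ltnn eqxx.
Qed.

Context (N0 : (0 < N)%N).

Let NR0 : 0 < N%:R :> R.
Proof. by rewrite ltr0n. Qed.

Lemma cond_weight_le1 x u : cond_weight x u <= 1.
Proof.
rewrite /cond_weight; case: ifP => // _.
by rewrite invf_le1 ?exprn_gt0 // exprn_ege1 // ler1n.
Qed.

Lemma cond_weight_forced x u d : c (size x) = Some d ->
  cond_weight (rcons x d) u <= cond_weight x u.
Proof.
move=> cd; rewrite {1}/cond_weight; case: ifP => [/eqP h|_]; last exact: cond_weight_ge0.
by rewrite /cond_weight (compatible_rcons h) eqxx size_rcons free_countS cd addn0.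
Qed.

Lemma cond_weight_free x u : c (size x) = None ->
  \sum_(d < N) cond_weight (rcons x d) u <= N%:R * cond_weight x u.
Proof.
move=> cn.
case: (boolP (take (size u) x == take (size x) u)) => [xu|nxu]; last first.
  rewrite big1 => [|d _]; first by rewrite mulr_ge0 ?ler0n ?cond_weight_ge0.
  rewrite /cond_weight; case: ifP => // /eqP h.
  by rewrite (compatible_rcons h) eqxx in nxu.
have -> : cond_weight x u = N%:R ^- (free_count (size u) - free_count (size x)).
  by rewrite /cond_weight xu.
case: (leqP (size u) (size x)) => sux.
  rewrite (eqP (_ : _ - _ == 0)%N) ?subn_eq0 ?leq_free_count // expr0 invr1 mulr1.
  apply: le_trans (ler_sum _ (fun d _ => cond_weight_le1 _ _)) _.
  by rewrite sumr_const card_ord.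
have fux : (free_count (size x) < free_count (size u))%N.
  by rewrite -addn1; have := leq_free_count sux; rewrite free_countS cn.
pose e := nth (Ordinal N0) u (size x).
rewrite (bigD1 e) //= big1 ?addr0 => [|d de]; last first.
  rewrite /cond_weight; case: ifP => // /eqP h.
  move: de; rewrite /e (compatible_nth sux h) => /eqP[].
  exact: set_nth_default.
rewrite {1}/cond_weight; case: ifP => _; last by rewrite mulr_ge0 ?invr_ge0 ?exprn_ge0.
rewrite size_rcons free_countS cn addn1 -(subSS (free_count (size x))) subSn //.
by rewrite exprS invfM mulVKf // gt_eqF.
Qed.

Definition total_weight (u : nat -> seq 'I_N) x :=
  (\sum_(0 <= k <oo) (cond_weight x (u k))%:E)%E.

(** Averaging over the free letters preserves the total conditional weight, so
    that one of them does not increase it. *)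
Lemma total_weight_step u x : (total_weight u x < 1)%E ->
  exists d, (forall d', c (size x) = Some d' -> d = d') /\
            (total_weight u (rcons x d) < 1)%E.
Proof.
move=> lt1; case cx : (c (size x)) => [d|].
  exists d; split => [d' [->]//|]; apply: le_lt_trans lt1.
  apply: lee_nneseries => k _; rewrite lee_fin ?cond_weight_ge0 //.
  exact: cond_weight_forced.
suff [d hd] : exists d, (total_weight u (rcons x d) < 1)%E by exists d.
apply: contrapT => nex.
have ge1 d : (1 <= total_weight u (rcons x d))%E.
  by rewrite leNgt; apply/negP => h; apply: nex; exists d.
have : (\sum_(d < N) 1 <= \sum_(d < N) total_weight u (rcons x d))%E.
  by apply: lee_sum => d _.
rewrite -nneseries_sum; last by move=> d k _; rewrite lee_fin cond_weight_ge0.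
have h : (\sum_(0 <= k <oo) (\sum_(d < N) (cond_weight (rcons x d) (u k))%:E) <=
          N%:R%:E * total_weight u x)%E.
  rewrite -nneseriesZl; last by move=> k _; rewrite lee_fin cond_weight_ge0.
  apply: lee_nneseries => k _.
    by move=> _; apply: sume_ge0 => d _; rewrite lee_fin cond_weight_ge0.
  by rewrite sumEFin lee_fin cond_weight_free.
move=> /le_trans /(_ h); rewrite sumEFin sumr_const card_ord leNgt => /negP; apply.
by rewrite -[ltRHS]mule1 lte_pmul2l // lte_fin.
Qed.

(** Countably many cylinders of total mass less than 1 do not cover the sequence
    space: an admissible sequence that avoids them is built letter by letter. *)
Lemma avoid_cylinders (u : nat -> seq 'I_N) :
  (\sum_(0 <= k <oo) (N%:R ^- free_count (size (u k)) : R)%:E < 1)%E ->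
  exists j, admissible j /\ forall k, mkseq j (size (u k)) <> u k.
Proof.
move=> lt1.
have /choice[nxt nxtP] : forall x, exists d, (total_weight u x < 1)%E ->
    (forall d', c (size x) = Some d' -> d = d') /\ (total_weight u (rcons x d) < 1)%E.
  move=> x; have [/total_weight_step[d hd]|h] := pselect (total_weight u x < 1)%E.
    by exists d.
  by exists (Ordinal N0).
pose x n := iter n (fun x => rcons x (nxt x)) [::].
pose j n := nxt (x n).
have xE n : x n = mkseq j n by elim: n => // n IH; rewrite mkseqS -IH.
have x1 n : (total_weight u (x n) < 1)%E.
  elim: n => [|n IH]; last by have [] := nxtP _ IH.
  apply: le_lt_trans lt1; apply: lee_nneseries => k _; rewrite lee_fin ?cond_weight_ge0 //.
  by rewrite (_ : x 0%N = [::]) // /cond_weight /= take0 eqxx {2}/free_count big_geq // subn0.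
exists j; split => [n d cn|k uk].
  have [+ _] := nxtP _ (x1 n); apply; rewrite xE size_mkseq //.
have := x1 (size (u k)); rewrite ltNge => /negP; apply.
apply: le_trans (nneseries_lim_ge k.+1 _) => [|i _ _]; last first.
  by rewrite lee_fin cond_weight_ge0.
rewrite big_nat_recr //= {2}/cond_weight xE uk eqxx subnn expr0 invr1.
by rewrite leeDr //; apply: sume_ge0 => i _; rewrite lee_fin cond_weight_ge0.
Qed.

End Avoidance.

(** * Cantor sets of digit expansions *)

Section DigitCantorSet.
Context (R : realType) (N Q : nat) (P : 'I_N -> int) (B : nat).
Context (Q2 : (2 <= Q)%N).
Context (PB : forall a, `|P a| <= B%:Z * (Q%:Z - 1)).
Context (gap : forall a b, a != b -> (2 * B + 1)%:Z <= `|P a - P b|).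

Let cQ := fun _ : 'I_N => Q.
Let cQ2 (a : 'I_N) : (2 <= cQ a)%N := Q2.

(** The sum of [P (j k) / Q ^ k.+1], seen as the coding for a system whose
    contraction ratios are all [1/Q], so that the facts on codings apply. *)
Definition digit_point (j : nat -> 'I_N) : R := coding_map R cQ P j.
Local Notation y := digit_point.

Let QR0 : 0 < Q%:R :> R.
Proof. by rewrite ltr0n; apply: leq_trans Q2. Qed.

Lemma wq_const (w : seq 'I_N) : wq cQ w = (Q ^ size w)%N.
Proof. by rewrite /wq big_const_seq iter_muln_1 count_predT. Qed.

Lemma digit_pointS j n :
  y j = wmap cQ P (mkseq j n) (y (fun t => j (n + t)%N)).
Proof. exact: (@coding_shift R N cQ P cQ2 B PB). Qed.

Lemma digit_point_bound j : `|y j| <= B%:R.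
Proof. exact: (@coding_bound R N cQ P cQ2 B PB). Qed.

Lemma digit_point_dist j j' n : mkseq j n = mkseq j' n ->
  `|y j - y j'| = `|y (fun t => j (n + t)%N) - y (fun t => j' (n + t)%N)| / Q%:R ^+ n.
Proof.
move=> e; rewrite (digit_pointS j n) (digit_pointS j' n) e wmapB // wq_const size_mkseq.
by rewrite normrM normfV natrX [`|_ ^+ n|]ger0_norm ?exprn_ge0.
Qed.

Lemma digit_point_close j j' n : mkseq j n = mkseq j' n ->
  `|y j - y j'| <= (2 * B)%:R / Q%:R ^+ n.
Proof.
move=> /digit_point_dist ->; rewrite ler_pM2r ?invr_gt0 ?exprn_gt0 //.
by rewrite (le_trans (ler_normB _ _)) // mul2n -addnn natrD lerD ?digit_point_bound.
Qed.

(** The gap between digits exceeds the width of the whole set, so sequences that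
    part at position [i] are at distance at least [Q^-(i+1)]. *)
Lemma digit_point_separated j j' n : mkseq j n <> mkseq j' n ->
  Q%:R ^- n <= `|y j - y j'|.
Proof.
move=> ne.
have [i [lti ei ji]] : exists i, [/\ (i < n)%N, mkseq j i = mkseq j' i & j i != j' i].
  elim: n ne => // n IH; rewrite !mkseqS => ne.
  have [e|/IH[i [? ? ?]]] := pselect (mkseq j n = mkseq j' n); last first.
    by exists i; split => //; apply: ltnW.
  exists n; split => //; apply/eqP => jn; apply: ne; by rewrite e jn.
apply: le_trans (_ : Q%:R ^- i.+1 <= _).
  by rewrite lef_pV2 ?posrE ?exprn_gt0 // ler_eXn2l // ltr1n.
rewrite (digit_point_dist ei) exprS invfM ler_pM2r ?invr_gt0 ?exprn_gt0 //.
rewrite (digit_pointS _ 1) (digit_pointS (fun t => j' (i + t)%N) 1).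
rewrite /mkseq /= /wmap /= /wq !big_cons big_nil !muln1 !mul1r !add0r !addn0 -mulrBl normrM normfV.
rewrite [`|Q%:R|]gtr0_norm // ler_peMl ?invr_ge0 ?(ltW QR0) //.
have := gap ji; rewrite -(ler_int R) intr_norm rmorphB /= -pmulrn natrD natrM.
have := digit_point_bound (fun t => j (i + (1 + t))%N).
have := digit_point_bound (fun t => j' (i + (1 + t))%N).
rewrite !ler_norml => /andP[? ?] /andP[? ?].
by case: (ger0P ((P (j i))%:~R - (P (j' i))%:~R : R)) => ? ?;
  [apply: le_trans (ler_norm _)|rewrite -normrN; apply: le_trans (ler_norm _)]; lra.
Qed.

Context (c : nat -> option 'I_N).
Local Notation fr := (free_count c).

(** Mass distribution principle: a set of diameter below [Q^-l] meets at most
    one cylinder of length [l], whose mass is [N^-(fr l)]. *)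
Lemma hausdorff_dim_digit_set (A : set R) (t M : R) : (0 < N)%N -> 0 < M ->
  (forall l, N%:R ^- fr l <= M * (Q%:R ^- l) `^ t) ->
  (forall j, admissible c j -> A (y j)) ->
  (t%:E <= hausdorff_dim A)%E.
Proof.
move=> N0 M0 mass yA; apply: le_ereal_inf_tmp => _ [s [s0 sA] <-].
rewrite lee_fin leNgt; apply/negP => st.
have t0 : 0 < t by apply: le_lt_trans st.
have QV0 l : 0 < (Q%:R : R) ^- l by rewrite invr_gt0 exprn_gt0.
have QV1 l : (Q%:R : R) ^- l <= 1.
  by rewrite invf_le1 ?exprn_gt0 // exprn_ege1 // ler1n ltnW.
have Qsmall (d : R) : 0 < d -> exists l, Q%:R ^- l < d.
  move=> d0; have /cvgrPdist_lt/(_ _ d0) [l _ /(_ _ (leqnn l))] := @cvg_div2X R 1.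
  rewrite /= sub0r normrN mul1r ger0_norm ?invr_ge0 ?exprn_ge0 // => h.
  exists l; apply: le_lt_trans h; rewrite lef_pV2 ?posrE ?exprn_gt0 //.
  by rewrite lerXn2r ?nnegrE // ?ler_nat.
have deep (d : R) : 0 < d -> exists l, (N%:R : R) ^- fr l <= d.
  move=> d0; have [|l hl] := Qsmall ((d / M) `^ t^-1); first by rewrite powR_gt0 ?divr_gt0.
  exists l; apply: le_trans (mass l) _; rewrite mulrC -ler_pdivlMr //.
  have := @gt0_ltr_powR R t t0 _ _ _ _ hl; rewrite -powRrM mulVf ?gt_eqF //.
  rewrite powRr1 ?divr_ge0 ?(ltW d0) ?(ltW M0) // => h; apply/ltW/h; rewrite nnegrE ?powR_ge0 //.
(* The factor [Q ^ s] pays for rounding a diameter up to a power of [1/Q]. *)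
pose M' := M * Q%:R `^ s.
have M'0 : 0 < M' by rewrite mulr_gt0 ?powR_gt0.
have : (hausdorff_premeasure s (2^-1) A < (4^-1 / M')%:E)%E.
  apply: le_lt_trans (_ : 0 < _)%E; last by rewrite lte_fin divr_gt0 ?invr_gt0.
  by rewrite -sA; apply: ereal_sup_ubound; exists 2^-1 => //=; rewrite invr_gt0.
move=> /ereal_inf_lt[_ [U [AU Ud] <-] hU].
(* A set of positive diameter fits in a cylinder whose mass is comparable to
   its weight; a set that is a point or misses the Cantor set is put in a
   cylinder of mass at most a term of a geometric series. *)
have cyl k : exists w : seq 'I_N,
    (forall j, admissible c j -> U k (y j) -> mkseq j (size w) = w) /\
    ((N%:R ^- fr (size w))%:E <=
      M'%:E * diam_pow s (U k) + (4^-1 / (2 ^ k.+1)%:R)%:E)%E.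
  have e0 : 0 < 4^-1 / (2 ^ k.+1)%:R :> R.
    by rewrite divr_gt0 ?invr_gt0 // ltr0n expn_gt0.
  have [l1 hl1] := deep _ e0.
  have bound1 : ((N%:R ^- fr l1)%:E <=
      M'%:E * diam_pow s (U k) + (4^-1 / (2 ^ k.+1)%:R)%:E)%E.
    apply: (@le_trans _ _ (4^-1 / (2 ^ k.+1)%:R)%:E); first by rewrite lee_fin.
    by rewrite leeDr // mule_ge0 ?diam_pow_ge0 // lee_fin ltW.
  have [[j0 [adj0 Uj0]]|none] := pselect (exists j, admissible c j /\ U k (y j)); last first.
    exists (nseq l1 (Ordinal N0)); rewrite size_nseq; split => // j adj Uj.
    by case: none; exists j.
  have dfin : diam (U k) \is a fin_num.
    rewrite ge0_fin_numE; last by apply: le_trans (dist_le_diam Uj0 Uj0); rewrite lee_fin.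
    exact: le_lt_trans (Ud k) (ltry _).
  have dle j : U k (y j) -> `|y j - y j0| <= fine (diam (U k)).
    by move=> Uj; rewrite -lee_fin fineK // dist_le_diam.
  move: (Ud k) dle; rewrite -{1}(fineK dfin) lee_fin.
  have : 0 <= fine (diam (U k)).
    by rewrite -lee_fin fineK //; apply: le_trans (dist_le_diam Uj0 Uj0); rewrite lee_fin.
  set d := fine _; rewrite le_eqVlt => /orP[/eqP <-|d0] d12 dle.
    exists (mkseq j0 l1); rewrite size_mkseq; split => // j _ /dle h.
    apply: contrapT => /digit_point_separated; rewrite leNgt => /negP; apply.
    exact: le_lt_trans h (QV0 _).
  have [l [hl1' hl2']] : exists l, Q%:R ^- l.+1 <= d /\ d < Q%:R ^- l.
    have ex : exists l, (Q%:R : R) ^- l <= d.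
      by have [l h] := Qsmall d d0; exists l; apply: ltW.
    case: (ex_minnP ex) => [[|l] hl lmin].
      by move: hl; rewrite expr0 invr1 => h; have : (1 : R) <= 2^-1 := le_trans h d12; lra.
    exists l; split => //; rewrite ltNge; apply/negP => /lmin; by rewrite ltnn.
  exists (mkseq j0 l); rewrite size_mkseq; split => [j _ /dle h|].
    apply: contrapT => /digit_point_separated; rewrite leNgt => /negP; apply.
    exact: le_lt_trans h hl2'.
  apply: (@le_trans _ _ (M'%:E * diam_pow s (U k))%E); last by rewrite leeDl // lee_fin ltW.
  have -> : diam_pow s (U k) = (d `^ s)%:E.
    rewrite /diam_pow -(fineK dfin) -/d poweR_EFin; case: ifPn => // /eqP U0.
    by move: Uj0; rewrite U0.
  rewrite -EFinM lee_fin; apply: le_trans (mass l) _.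
  rewrite /M' -mulrA ler_pM2l //.
  apply: le_trans (_ : (Q%:R ^- l) `^ s <= _).
    by apply: ger_powR; rewrite ?QV0 ?QV1 // ltW.
  rewrite -powRM ?(ltW QR0) ?(ltW d0) //; apply: ge0_ler_powR;
    rewrite ?nnegrE ?mulr_ge0 ?(ltW QR0) ?(ltW d0) ?(ltW (QV0 _)) //.
  rewrite -(ler_pM2l (_ : 0 < Q%:R^-1)) ?invr_gt0 // mulKf ?gt_eqF //.
  by move: hl1'; rewrite exprS invfM.
have /choice[w wP] := cyl.
have [//|j [adj hj]] := @avoid_cylinders R N c N0 w.
  apply: le_lt_trans (_ : M'%:E * \sum_(0 <= k <oo) diam_pow s (U k) + 4^-1%:E < _)%E.
    rewrite -nneseriesZl; last by move=> k _; exact: diam_pow_ge0.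
    apply: le_trans (epsilon_trick _ _ _); last 2 first.
    - by move=> k; rewrite mule_ge0 ?diam_pow_ge0 // lee_fin ltW.
    - by rewrite invr_ge0.
    apply: lee_nneseries => k _; last by have [] := wP k.
    by rewrite lee_fin invr_ge0 exprn_ge0.
  apply: (@lt_trans _ _ (4^-1 + 4^-1)%:E); last by rewrite lte_fin; lra.
  rewrite EFinD lte_leD ?fin_numE //.
  have -> : (4^-1)%:E = (M'%:E * (4^-1 / M')%:E)%E :> \bar R.
    by rewrite -EFinM mulrCA divff ?gt_eqF // mulr1.
  by rewrite lte_pmul2l // lte_fin.
have [k _ Uk] := AU _ (yA _ adj).
by apply: (hj k); have [h _] := wP k; apply: h.
Qed.

End DigitCantorSet.

Lemma infinite_range (T : choiceType) (A : set T) (f : nat -> T) :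
  injective f -> (forall n, A (f n)) -> infinite_set A.
Proof.
move=> finj fA finA; apply: infinite_nat.
rewrite -(_ : f @^-1` A = [set: nat]); last by apply/seteqP; split => n _ //; exact: fA.
by apply: finite_preimage => // a b _ _; exact: finj.
Qed.

Lemma powR_exprVn (R : realType) (x t : R) n : 0 <= x ->
  (x ^- n) `^ t = (x `^ t) ^- n.
Proof. by move=> x0; rewrite -powR_invn // powRAC powR_invn ?powR_ge0. Qed.

(** * Subsystems with equal contraction ratios *)

Section Subsystem.
Context (R : realType) (m : nat) (q : 'I_m -> nat) (p : 'I_m -> int).
Context (K : set R).
Context (hq : forall i, (2 <= q i)%N).
Context (hK : is_attractor q p K).
Context (N Q B : nat) (W : 'I_N -> seq 'I_m).
Context (WQ : forall a, wq q (W a) = Q).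
Context (Q2 : (2 <= Q)%N).
Context (hB : forall i, `|p i| <= B%:Z * ((q i)%:Z - 1)).

Let P a := wp q p (W a).

Lemma subsystem_digit_bound a : `|P a| <= B%:Z * (Q%:Z - 1).
Proof. by rewrite -(WQ a); exact: wp_bound. Qed.

Lemma wmap_subsystem (F : numFieldType) (u : seq 'I_N) (x : F) :
  wmap (fun=> Q) P u x = wmap q p (flatten (map W u)) x.
Proof.
elim: u => [|a u IH] /=; first by rewrite !wmap_nil.
by rewrite wmap_cons // wmap_cat // IH -mulrDl {2}/wmap WQ.
Qed.

Lemma wq_subsystem (u : seq 'I_N) :
  wq q (flatten (map W u)) = (Q ^ size u)%N.
Proof.
elim: u => [|a u IH] /=; first by rewrite /wq big_nil.
by rewrite wq_cat WQ IH expnS.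
Qed.

(** Every prefix of the digit sequence maps [K] into [K], so the point is a limit of
    points of [K]. *)
Lemma subsystem_attractor j : K (digit_point R Q P j).
Proof.
have [M hM] := attractor_bounded hK.
have [[a Ka] _ _] := hK.
apply: (attractor_limit hK) => e e0.
have /cvgrPdist_le/(_ _ e0) [n _ /(_ _ (leqnn n))] := cvg_div2X (M + B%:R).
rewrite /= sub0r normrN => h.
exists (wmap (fun=> Q) P (mkseq j n) a).
  by rewrite wmap_subsystem; apply: attractor_wmap.
rewrite (digit_pointS R Q2 subsystem_digit_bound j n).
apply: le_trans (le_trans (ler_norm _) h).
rewrite -[in leRHS](size_mkseq j n); apply: wmap_dist => //.
rewrite (le_trans (ler_normB _ _)) // addrC lerD ?hM //.
exact: (digit_point_bound R Q2 subsystem_digit_bound).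
Qed.

End Subsystem.

(** * Counting the distinct maps of the semigroup *)

Section DigitCount.
Context (R : realType) (m : nat) (q : 'I_m -> nat) (p : 'I_m -> int).
Context (hq : forall i, (2 <= q i)%N).
Context (B : nat).
Context (hB : forall i, `|p i| <= B%:Z * ((q i)%:Z - 1)).

(** At most [(2B+1) Q^s] digits for each denominator [Q]. The constant is the
    factor lost in [well_spaced_subsystem] by passing to one residue class. *)
Definition digits_le (s : R) := forall (Q : nat) (S : seq int), uniq S ->
  (forall P, P \in S -> exists2 w, wq q w = Q & wp q p w = P) ->
  (size S)%:R <= (2 * B + 1)%:R * Q%:R `^ s.

Lemma size_int_ball (X : nat) (S : seq int) : uniq S ->
  (forall P, P \in S -> `|P| <= X%:Z) -> (size S <= 2 * X + 1)%N.
Proof.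
move=> uS hS; rewrite -(size_iota 0 (2 * X + 1)) -(size_map (fun P => absz (P + X%:Z))).
apply: uniq_leq_size.
  by rewrite map_inj_in_uniq // => a b /hS ha /hS hb; lia.
by move=> _ /mapP[P /hS hP ->]; rewrite mem_iota; lia.
Qed.

(** The digits of denominator [Q] are integers of absolute value at most
    [B (Q - 1)]. *)
Lemma digits_le1 : digits_le 1.
Proof.
move=> Q S uS hS; case: S uS hS => [|P0 S] uS hS; first by rewrite mulr_ge0 ?powR_ge0.
have [w0 wQ _] := hS P0 (mem_head _ _).
have Q0 : (0 < Q)%N by rewrite -wQ wq_gt0.
rewrite powRr1 // -natrM ler_nat.
apply: leq_trans (size_int_ball (X := B * (Q - 1)) uS _) _ => [P /hS[w wE <-]|]; last by nia.
by have := wp_bound w hB; rewrite wE; nia.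
Qed.

(** Pigeonhole on residues modulo [2B+1]. The case [Q = 1] does not occur: only the
    empty word has denominator 1, and it has one digit. *)
Lemma well_spaced_subsystem s : 0 <= s -> ~ digits_le s ->
  exists Q N (W : 'I_N -> seq 'I_m),
  [/\ (2 <= Q)%N, forall a, wq q (W a) = Q,
      forall a b, a != b -> (2 * B + 1)%:Z <= `|wp q p (W a) - wp q p (W b)| &
      Q%:R `^ s < N%:R :> R].
Proof.
move=> s0 nd; pose G := (2 * B).+1; have GE : (2 * B + 1 = G)%N by rewrite addn1.
have [Q [S [uS hS ltS]]] : exists Q (S : seq int), [/\ uniq S,
    forall P, P \in S -> exists2 w, wq q w = Q & wp q p w = P &
    G%:R * Q%:R `^ s < (size S)%:R].
  rewrite -GE; apply: contrapT => h; apply: nd => Q S uS hS; rewrite leNgt; apply/negP => lt.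
  by apply: h; exists Q, S.
have Q2 : (2 <= Q)%N.
  rewrite ltnNge; apply/negP => Q1.
  have S1 : (size S <= 1)%N.
    apply: (@uniq_leq_size _ S [:: 0]) => // P /hS[w wQ <-]; rewrite inE.
    by case: w wQ => // i w; have := wq_ge2X hq (i :: w); rewrite /= expnS => h wQ;
      have := expn_gt0 2 (size w); lia.
  move: ltS; rewrite ltNge => /negP; apply.
  case: S uS hS S1 => [|P S] uS hS S1; first by rewrite mulr_ge0 ?powR_ge0.
  have [w wQ _] := hS P (mem_head _ _).
  have -> : Q = 1%N by have := wq_gt0 hq w; rewrite wQ; lia.
  by rewrite powR1 mulr1 ler_nat /G; lia.
pose cls (r : 'I_G) := [seq P <- S | (P %% G%:Z)%Z == r%:Z].
have [r hr] : exists r, Q%:R `^ s < (size (cls r))%:R.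
  apply: contrapT => nr.
  have hle r : (size (cls r))%:R <= Q%:R `^ s :> R.
    by rewrite leNgt; apply/negP => h; apply: nr; exists r.
  have szE : (size S = \sum_(r < G) size (cls r))%N.
    rewrite -sum1_size (partition_big (fun P => inord (absz (P %% G%:Z)%Z) : 'I_G) xpredT) //=.
    apply: eq_bigr => r _; rewrite -sum1_size big_filter; apply: eq_bigl => P.
    have P0 : 0 <= (P %% G%:Z)%Z by rewrite modz_ge0.
    have PG : (P %% G%:Z)%Z < G%:Z by rewrite ltz_pmod.
    rewrite -(inj_eq val_inj) /= inordK; last by lia.
    by apply/eqP/eqP; lia.
  move: ltS; rewrite szE natr_sum ltNge => /negP; apply.
  apply: le_trans (ler_sum _ (fun r _ => hle r)) _.
  by rewrite sumr_const card_ord mulr_natl.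
have /choice[W hW] : forall a : 'I_(size (cls r)), exists w, wq q w = Q /\ wp q p w = nth 0 (cls r) a.
  move=> a; have : nth 0 (cls r) a \in cls r by exact: mem_nth.
  by rewrite mem_filter => /andP[_ /hS[w ? ?]]; exists w.
exists Q, (size (cls r)), W; split => // [a|a b ab]; first by have [] := hW a.
have [_ ->] := hW a; have [_ ->] := hW b.
have : nth 0 (cls r) a != nth 0 (cls r) b.
  by rewrite nth_uniq ?filter_uniq.
have : nth 0 (cls r) a \in cls r by exact: mem_nth.
have : nth 0 (cls r) b \in cls r by exact: mem_nth.
rewrite !mem_filter => /andP[/eqP hb _] /andP[/eqP ha _].
rewrite (divz_eq (nth 0 (cls r) a) G%:Z) (divz_eq (nth 0 (cls r) b) G%:Z) ha hb.
move: (_ %/ _)%Z (_ %/ _)%Z => x x'.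
have [->|xx'] := eqVneq x x'; first by rewrite eqxx.
rewrite opprD addrACA subrr addr0 -mulrBl normrM GE => _; nia.
Qed.


Lemma prod_count_mem (F : comNzRingType) (g : 'I_m -> F) w :
  \prod_(i <- w) g i = \prod_i g i ^+ count_mem i w.
Proof.
elim: w => [|x w IH]; first by rewrite big_nil big1 // => i _; rewrite expr0.
rewrite big_cons IH; under [RHS]eq_bigr => i _ do rewrite /= exprD.
rewrite big_split /=; congr (_ * _).
by rewrite (bigD1 x) //= eqxx big1 ?mulr1 // => i; rewrite eq_sym => /negPf ->.
Qed.

Lemma wq_powR w (t : R) :
  (wq q w)%:R `^ t = \prod_i ((q i)%:R `^ t) ^+ count_mem i w.
Proof.
rewrite -prod_count_mem; elim: w => [|i w IH]; first by rewrite /wq !big_nil powR1.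
by rewrite wq_cons natrM powRM // big_cons IH.
Qed.

(** Euler product bound: every contraction denominator is a product of powers
    of the [q i], whatever the order of the letters. *)
Lemma sum_denominators (e : R) (L : nat) : 0 < e ->
  \sum_(Q < L | `[< exists w, wq q w = Q >]) (Q : nat)%:R `^ (- e) <=
    (1 - 2 `^ (- e))^-1 ^+ m.
Proof.
move=> e0.
have /choice[f fP] : forall Q : 'I_L, exists f : {ffun 'I_m -> 'I_L},
    (exists w, wq q w = Q) ->
    forall t : R, (Q : nat)%:R `^ t = \prod_i ((q i)%:R `^ t) ^+ f i.
  move=> Q; have [[w wQ]|nQ] := pselect (exists w, wq q w = Q); last by exists [ffun=> Q].
  exists [ffun i => insubd Q (count_mem i w)] => _ t.
  rewrite -wQ wq_powR; apply: eq_bigr => i _; rewrite ffunE val_insubd.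
  case: ifPn => // /negP[].
  apply: leq_ltn_trans (ltn_ord Q); rewrite -wQ.
  apply: leq_trans (wq_ge2X hq w).
  by apply: leq_trans (count_size _ _) _; apply: ltnW; exact: ltn_expl.
pose x i := (q i)%:R `^ (- e) : R.
pose D : {pred 'I_L} := fun Q => `[< exists w, wq q w = Q >].
have -> : \sum_(Q < L | `[< exists w, wq q w = Q >]) (Q : nat)%:R `^ (- e) =
    \sum_(Q in D) (fun g : {ffun 'I_m -> 'I_L} => \prod_i x i ^+ g i) (f Q).
  by apply: eq_bigr => Q /asboolP h; rewrite (fP _ h).
rewrite -(big_imset (fun g : {ffun 'I_m -> 'I_L} => \prod_i x i ^+ g i)) /=; last first.
  move=> Q Q' /asboolP h /asboolP h' fQ; apply/val_inj/eqP => /=.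
  rewrite -(eqr_nat R) -[X in X == _]powRr1 // -[X in _ == X]powRr1 //.
  by rewrite (fP _ h) (fP _ h') fQ.
have x0 i : 0 <= x i by exact: powR_ge0.
have y1 : 2 `^ (- e) < 1 :> R.
  rewrite powRN invf_lt1 ?powR_gt0 // -[X in X < _](_ : 1 `^ e = 1); last by rewrite powR1.
  by apply: gt0_ltr_powR; rewrite ?nnegrE ?ltr1n.
apply: (@le_trans _ _ (\sum_(g : {ffun 'I_m -> 'I_L}) \prod_i x i ^+ g i)).
  rewrite big_mkcond; apply: ler_sum => g _; case: ifP => // _.
  by apply: prodr_ge0 => i _; rewrite exprn_ge0.
rewrite -(bigA_distr_bigA (fun i (k : 'I_L) => x i ^+ k)).
rewrite -[X in _ ^+ X]card_ord -prodr_const; apply: ler_prod => i _.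
apply/andP; split; first by apply: sumr_ge0 => k _; rewrite exprn_ge0.
have xy : x i <= 2 `^ (- e).
  rewrite /x !powRN lef_pV2 ?posrE ?powR_gt0 ?q_gt0 //.
  by apply: ge0_ler_powR; rewrite ?nnegrE ?(ltW e0) // ler_nat.
have x1 : x i < 1 by apply: le_lt_trans y1.
apply: (@le_trans _ _ (1 - x i)^-1); last first.
  by rewrite lef_pV2 ?posrE ?subr_gt0 // lerB.
rewrite -[leRHS]mul1r ler_pdivlMr ?subr_gt0 // mulrC.
have -> : (1 - x i) * \sum_(k < L) x i ^+ k = 1 - x i ^+ L.
  by rewrite -[1 - x i]opprB mulNr -subrX1 opprB.
by rewrite gerBl exprn_ge0.
Qed.

(** A map is identified with the pair of its denominator and its digit, so that
    words with the same map are counted once. *)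
Definition map_code (a : nat * int) := exists w, (wq q w, wp q p w) = a.

(** Grouping the maps by denominator bounds the sum by the sum of
    [D(Q) Q^-s <= (2B+1) Q^-(s-s0)], which the Euler product controls. *)
Lemma sum_maps_le s0 s : digits_le s0 -> s0 < s ->
  exists Z, forall F : seq (nat * int), uniq F ->
    (forall a, a \in F -> map_code a) ->
    \sum_(a <- F) (a.1)%:R `^ (- s) <= Z :> R.
Proof.
move=> hd s0s; have e0 : 0 < s - s0 by rewrite subr_gt0.
exists ((2 * B + 1)%:R * (1 - 2 `^ (- (s - s0)))^-1 ^+ m) => F uF hF.
pose L := \max_(a <- F) a.1.
have hL a : a \in F -> (a.1 < L.+1)%N.
  by move=> aF; rewrite ltnS /L; apply: leq_bigmax_seq.
rewrite (partition_big (fun a => inord a.1 : 'I_L.+1) xpredT) //=.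
apply: (@le_trans _ _ (\sum_(Q < L.+1 | `[< exists w, wq q w = Q >])
   (2 * B + 1)%:R * (Q : nat)%:R `^ (- (s - s0)))); last first.
  by rewrite -mulr_sumr ler_wpM2l // sum_denominators.
rewrite [leRHS]big_mkcond; apply: ler_sum => Q _.
have FQ : \sum_(a <- F | inord a.1 == Q) (a.1)%:R `^ (- s) =
    \sum_(a <- [seq a <- F | inord a.1 == Q]) (Q : nat)%:R `^ (- s) :> R.
  rewrite big_filter big_seq_cond [RHS]big_seq_cond; apply: eq_bigr => a /andP[aF /eqP <-].
  by rewrite inordK ?hL.
rewrite FQ big_const_seq iter_addr_0 count_predT -[_ *+ _]mulr_natl.
case: ifPn => [/asboolP[w wQ]|nQ].
  have Q0 : (0 < Q)%N by rewrite -wQ wq_gt0.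
  have -> : (Q : nat)%:R `^ (- (s - s0)) = (Q : nat)%:R `^ s0 * (Q : nat)%:R `^ (- s) :> R.
    by rewrite -powRD ?opprB // pnatr_eq0 -lt0n Q0 implybT.
  rewrite mulrA ler_wpM2r ?powR_ge0 //.
  rewrite -(size_map (fun a => a.2)); apply: hd.
    rewrite map_inj_in_uniq ?filter_uniq // => -[a1 a2] [b1 b2].
    rewrite !mem_filter => /andP[/eqP h1 /hL h2] /andP[/eqP h3 /hL h4] /= ->.
    by congr pair; move: (inordK h2) (inordK h4); rewrite h1 h3 /= => <- <-.
  move=> P /mapP[a]; rewrite mem_filter => /andP[/eqP h1 aF] ->.
  have [w' wa] := hF a aF; exists w'; last by rewrite -wa.
  by rewrite -h1 inordK ?hL // -wa.
case E : [seq a <- F | inord a.1 == Q] => [|a l]; first by rewrite mul0r.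
have : a \in [seq a <- F | inord a.1 == Q] by rewrite E mem_head.
rewrite mem_filter => /andP[/eqP h1 aF].
case/negP: nQ; apply/asboolP; have [w wa] := hF a aF; exists w.
by rewrite -h1 inordK ?hL // -wa.
Qed.

End DigitCount.

(** * The dimension of the attractor *)

Section AttractorDimension.
Context (R : realType) (m : nat) (q : 'I_m -> nat) (p : 'I_m -> int).
Context (K : set R) (B : nat).
Context (hq : forall i, (2 <= q i)%N).
Context (hK : is_attractor q p K).
Context (hB : forall i, `|p i| <= B%:Z * ((q i)%:Z - 1)).

(** A point of [K] lies in the image of [K] under infinitely many maps, namely those of
    the prefixes of a coding, and the diameters are summable to the power [s]. *)
Lemma hausdorff_measure_attractor s0 s : 0 < s -> digits_le q p B s0 -> s0 < s ->
  hausdorff_measure s K = 0%E.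
Proof.
move=> sgt0 hd s0s.
have [Z hZ] := sum_maps_le hq hd s0s.
have [M hM] := attractor_bounded hK.
have M0 : 0 <= M by have [[a Ka] _ _] := hK; apply: le_trans (hM a Ka).
pose V (a : nat * int) : set R :=
  [set y | exists w x, [/\ (wq q w, wp q p w) = a, K x & y = wmap q p w x]].
pose rho (a : nat * int) : R := if `[< map_code q p a >] then 2 * M / a.1%:R else 0.
apply: (@hausdorff_cantelli R _ V rho s ((2 * M) `^ s * Z)) => //.
- by move=> a; rewrite /rho; case: ifP => // _; rewrite divr_ge0 // mulr_ge0.
- move=> a x y [w [x' [wa Kx' ->]]] [w' [y' [wa' Ky' ->]]].
  have -> : wmap q p w' y' = wmap q p w y'.
    by move: wa'; rewrite -wa /wmap => -[-> ->].
  rewrite /rho; have -> : `[< map_code q p a >] by apply/asboolP; exists w.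
  rewrite wmapB // normrM normfV [`|_%:R|]ger0_norm // -wa /= ler_wpM2r ?invr_ge0 //.
  by rewrite (le_trans (ler_normB _ _)) // mulr_natl mulr2n lerD ?hM.
- move=> F uF.
  have rhoE a : rho a `^ s =
      if `[< map_code q p a >] then (2 * M) `^ s * a.1%:R `^ (- s) else 0.
    rewrite /rho; case: ifP => _; last by rewrite powR0 ?gt_eqF.
    by rewrite powRM ?invr_ge0 ?mulr_ge0 // -powR_inv1 // -powRrM mulN1r.
  under eq_bigr do rewrite rhoE.
  rewrite -big_mkcond -big_filter -mulr_sumr ler_wpM2l ?powR_ge0 //.
  apply: hZ; first exact: filter_uniq.
  by move=> a; rewrite mem_filter => /andP[/asboolP].
- move=> x Kx; have [j [z [z0 Kz zE]]] := attractor_orbit hK Kx.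
  apply: (@infinite_range _ _ (fun n => (wq q (mkseq j n), wp q p (mkseq j n)))).
    have lt n : (wq q (mkseq j n) < wq q (mkseq j n.+1))%N.
      rewrite mkseqS -cats1 wq_cat /wq big_seq1 -/(wq q _) ltn_Pmulr //.
      exact: wq_gt0.
    have mono := homo_ltn (f := fun n => wq q (mkseq j n)) ltn_trans lt.
    move=> a b [ab _]; case: (ltngtP a b) => // /mono; rewrite ab ltnn //.
  move=> n; exists (mkseq j n), (z n); split => //.
  by rewrite -z0; exact: orbit_wmap.
Qed.

Lemma attractor_dim_le s0 s : 0 < s -> digits_le q p B s0 -> s0 < s ->
  (hausdorff_dim K <= s%:E)%E.
Proof.
move=> sgt0 hd s0s; apply: hausdorff_dim_le; first exact: ltW.
exact: hausdorff_measure_attractor hd s0s.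
Qed.

(** The well-spaced subsystem gives a Cantor set in [K] without imposed digits. *)
Lemma attractor_dim_ge s : 0 <= s -> ~ digits_le q p B s ->
  (s%:E <= hausdorff_dim K)%E.
Proof.
move=> s0 /(well_spaced_subsystem hq s0)[Q [N [W [Q2 WQ gap ltN]]]].
have Qs : 0 < Q%:R `^ s :> R by rewrite powR_gt0 // ltr0n; apply: leq_trans Q2.
have N0 : (0 < N)%N by rewrite -(ltr_nat R); apply: lt_trans ltN.
apply: (@hausdorff_dim_digit_set R N Q _ B Q2 (subsystem_digit_bound WQ hB) gap
  (fun=> None) K s 1) => // [l|j _]; last first.
  exact: (subsystem_attractor hq hK WQ Q2 hB).
have -> : free_count (fun _ => None : option 'I_N) l = l.
  by rewrite /free_count big_const_nat iter_addn subn0 mul1n addn0.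
rewrite mul1r powR_exprVn // lef_pV2 ?posrE ?exprn_gt0 ?ltr0n //.
by rewrite lerXn2r ?nnegrE ?powR_ge0 // ltW.
Qed.

Lemma attractor_dim_fin : hausdorff_dim K \is a fin_num.
Proof.
rewrite ge0_fin_numE ?hausdorff_dim_ge0 //; apply: le_lt_trans (ltry 2).
by apply: (attractor_dim_le _ (digits_le1 R hq hB)) => //; rewrite ltr1n.
Qed.

End AttractorDimension.

(** * Intrinsic heights and the upper bound *)

Lemma ler_sum_sub (R : numDomainType) (T : eqType) (s t : seq T) (g : T -> R) :
  uniq s -> uniq t -> {subset s <= t} -> (forall x, 0 <= g x) ->
  \sum_(x <- s) g x <= \sum_(x <- t) g x.
Proof.
move=> us ut st g0; rewrite [leRHS](bigID (mem s)) /= -[X in _ <= X + _]big_filter.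
have -> : \sum_(x <- [seq x <- t | x \in s]) g x = \sum_(x <- s) g x; last first.
  by rewrite lerDl sumr_ge0.
apply: perm_big; apply: uniq_perm; rewrite ?filter_uniq // => x; rewrite mem_filter.
by case: (boolP (x \in s)) => // /st ->.
Qed.

Section IntrinsicHeight.
Context (R : realType) (m : nat) (q : 'I_m -> nat) (p : 'I_m -> int).
Context (K : set R) (B : nat).
Context (hq : forall i, (2 <= q i)%N).
Context (hK : is_attractor q p K).
Context (hB : forall i, `|p i| <= B%:Z * ((q i)%:Z - 1)).
Local Notation h_int := (h_int R q p).
Local Notation heights := (heights R q p).

Lemma h_intP r : heights r !=set0 ->
  heights r (h_int r) /\ forall h, heights r h -> (h_int r <= h)%N.
Proof.
move=> [h0 hh0].
apply: (@xgetPex _ 0%N [set h | heights r h /\ forall h', heights r h' -> (h <= h')%N]).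
have ex : exists h, `[< heights r h >] by exists h0; apply/asboolP.
case: (ex_minnP ex) => h /asboolP hh hmin.
by exists h; split => // h' hh'; apply: hmin; apply/asboolP.
Qed.

Lemma h_int_words r : K (ratr r) -> exists u v, [/\ v != [::],
  ratr r = wmap q p u (wfix q p R v) & h_int r = (wq q u * (wq q v - 1))%N].
Proof.
move=> Kr; have [[n [w [k [rE hE]]]] _] := h_intP (heights_nonempty hq hK Kr).
exists (take k w), (drop k w); split.
- by rewrite -size_eq0 size_drop size_tuple subn_eq0 -ltnNge.
- by rewrite rE word_seq_coding.
- by rewrite hE word_heightE.
Qed.

Lemma h_int_gt0 r : K (ratr r) -> (0 < h_int r)%N.
Proof.
move=> /h_int_words[u [v [v0 _ ->]]]; rewrite muln_gt0 wq_gt0 // subn_gt0.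
apply: leq_trans (wq_ge2X hq v); rewrite -{1}(expn0 2) ltn_exp2l //.
by case: v v0.
Qed.

(** A rational is determined by the contraction of the preperiod and that of the
    period, and its height is comparable to the product of the two
    denominators. *)
Lemma sum_h_int_le s0 s : 0 < s -> digits_le q p B s0 -> s0 < s ->
  exists Z, forall F : seq rat, uniq F -> (forall r, r \in F -> K (ratr r)) ->
    \sum_(r <- F) (h_int r)%:R `^ (- s) <= Z :> R.
Proof.
move=> sgt0 hd s0s; have [Z hZ] := sum_maps_le hq hd s0s.
exists (2 `^ s * (Z * Z)) => F uF FK.
have /choice[uv uvP] : forall r : rat, exists uv : seq 'I_m * seq 'I_m, K (ratr r) ->
    [/\ uv.2 != [::], ratr r = wmap q p uv.1 (wfix q p R uv.2) &
        h_int r = (wq q uv.1 * (wq q uv.2 - 1))%N].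
  move=> r; have [/h_int_words[u [v ?]]|?] := pselect (K (ratr r)); last by exists ([::], [::]).
  by exists (u, v).
pose cd w := (wq q w, wp q p w).
pose c r := (cd (uv r).1, cd (uv r).2).
pose g (a : nat * int) : R := a.1%:R `^ (- s).
have g0 a : 0 <= g a by exact: powR_ge0.
have hg r : r \in F -> (h_int r)%:R `^ (- s) <= 2 `^ s * (g (c r).1 * g (c r).2).
  move=> /FK /uvP[v0 _ ->]; rewrite /g /=; set a := wq q _; set b := wq q _.
  have a0 : (0 < a)%N by exact: wq_gt0.
  have b2 : (2 <= b)%N.
    apply: leq_trans (wq_ge2X hq _); rewrite -{1}(expn1 2) leq_exp2l //.
    by case: (uv r).2 v0.
  have -> : 2 `^ s * (a%:R `^ (- s) * b%:R `^ (- s)) = ((a * b)%:R / 2) `^ (- s) :> R.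
    rewrite natrM -powRM // [RHS]powRM ?mulr_ge0 // [RHS]mulrC; congr (_ * _).
    by rewrite -powR_inv1 // -powRrM mulrN mulN1r opprK.
  rewrite !powRN lef_pV2 ?posrE ?powR_gt0 ?divr_gt0 ?ltr0n ?muln_gt0 ?a0 ?subn_gt0 //; last first.
    by rewrite (leq_trans _ b2).
  apply: ge0_ler_powR; rewrite ?nnegrE ?(ltW sgt0) ?divr_ge0 //.
  by rewrite ler_pdivrMr // -natrM ler_nat -mulnA leq_mul2l; apply/orP; right; lia.
apply: (@le_trans _ _ (\sum_(r <- F) 2 `^ s * (g (c r).1 * g (c r).2))).
  by rewrite big_seq [leRHS]big_seq; apply: ler_sum => r; exact: hg.
rewrite -mulr_sumr ler_wpM2l ?powR_ge0 //.
rewrite -(big_map c xpredT (fun ab => g ab.1 * g ab.2)) /=.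
have uc : uniq (map c F).
  rewrite map_inj_in_uniq // => r r' /FK /uvP[_ h1 _] /FK /uvP[_ h2 _] [e1 e2 e3 e4].
  have er : ratr r = ratr r' :> R by rewrite h1 h2 /wmap /wfix e1 e2 e3 e4.
  exact: fmorph_inj er.
pose F1 := undup (map (fun r => (c r).1) F); pose F2 := undup (map (fun r => (c r).2) F).
apply: (@le_trans _ _ (\sum_(ab <- [seq (a, b) | a <- F1, b <- F2]) g ab.1 * g ab.2)).
  apply: ler_sum_sub => // [||ab].
  - by apply: allpairs_uniq; rewrite ?undup_uniq // => -[? ?] [? ?].
  - move=> _ /mapP[r rF ->]; apply/allpairsP; exists (c r); split.
    + by rewrite mem_undup; apply/mapP; exists r.
    + by rewrite mem_undup; apply/mapP; exists r.
    + by case: (c r).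
  - by rewrite mulr_ge0.
rewrite big_allpairs_dep /=.
under eq_bigr do rewrite -mulr_sumr.
rewrite -mulr_suml; apply: ler_pM.
- by apply: sumr_ge0 => *.
- by apply: sumr_ge0 => *.
- apply: hZ; first exact: undup_uniq.
  by move=> a; rewrite mem_undup => /mapP[r _ ->]; exists (uv r).1.
- apply: hZ; first exact: undup_uniq.
  by move=> a; rewrite mem_undup => /mapP[r _ ->]; exists (uv r).2.
Qed.

(** The intervals of radius [psi (h_int r)] around the rationals of [K] cover each point
    of the set infinitely often. *)
Lemma E_int_dim_le (psi : nat -> R) s0 s sigma C :
  digits_le q p B s0 -> s0 < s -> 0 < s -> 0 < sigma -> 0 <= C ->
  (forall n, (0 < n)%N -> psi n <= C * n%:R `^ (- sigma)) ->
  (hausdorff_dim (E_int q p K psi) <= (s / sigma)%:E)%E.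
Proof.
move=> hd s0s sgt0 sigma0 C0 psile.
have [Z hZ] := sum_h_int_le sgt0 hd s0s.
have t0 : 0 < s / sigma by rewrite divr_gt0.
apply: hausdorff_dim_le; first exact: ltW.
pose V (r : rat) : set R := [set x | K (ratr r) /\ `|x - ratr r| <= psi (h_int r)].
pose rho (r : rat) : R :=
  if `[< K (ratr r) >] then 2 * C * (h_int r)%:R `^ (- sigma) else 0.
apply: (@hausdorff_cantelli R _ V rho _ ((2 * C) `^ (s / sigma) * Z)) => //.
- by move=> r; rewrite /rho; case: ifP => // _; rewrite !mulr_ge0 ?powR_ge0.
- move=> r x y [Kr xr] [_ yr]; rewrite /rho; have -> : `[< K (ratr r) >] by apply/asboolP.
  have -> : x - y = (x - ratr r) - (y - ratr r) by ring.
  rewrite (le_trans (ler_normB _ _)) // -mulrA mulr_natl mulr2n.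
  by rewrite lerD // (le_trans _ (psile _ (h_int_gt0 Kr))).
- move=> F uF.
  have rhoE r : rho r `^ (s / sigma) = if `[< K (ratr r) >]
      then (2 * C) `^ (s / sigma) * (h_int r)%:R `^ (- s) else 0.
    rewrite /rho; case: ifP => _; last by rewrite powR0 ?gt_eqF.
    rewrite powRM ?mulr_ge0 ?powR_ge0 // -powRrM; congr (_ * _ `^ _).
    by rewrite mulNr mulrCA divff ?gt_eqF // mulr1.
  under eq_bigr do rewrite rhoE.
  rewrite -big_mkcond -big_filter -mulr_sumr ler_wpM2l ?powR_ge0 //.
  apply: hZ; first exact: filter_uniq.
  by move=> a; rewrite mem_filter => /andP[/asboolP].
- by move=> x [_ h].
Qed.

End IntrinsicHeight.

(** * The exponent of the approximation function *)

Section DeltaExponent.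
Context (R : realType) (psi : nat -> R).
Context (psi_ge0 : forall n, 0 <= psi n).

Let u n : \bar R := (- lne (psi n)%:E / lne (n%:R)%:E)%E.

(** For [n >= 2] the denominator [ln n] is positive, so the quotient takes no
    degenerate value other than [+oo], when [psi n = 0]. *)
Lemma delta_termE n : (2 <= n)%N ->
  u n = if psi n == 0 then +oo%E else (- ln (psi n) / ln n%:R)%:E.
Proof.
move=> n2; have n1 : 1 < n%:R :> R by rewrite ltr1n.
have n0 : 0 < n%:R :> R by apply: lt_trans n1.
rewrite /u [lne n%:R%:E]lne_EFin // inver gt_eqF ?ln_gt0 //.
have [->|p0] := eqVneq (psi n) 0; last by rewrite lne_EFin ?lt0r ?p0 //= psi_ge0.
by rewrite le0_lneNy //= gt0_mulye // lte_fin invr_gt0 ln_gt0.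
Qed.

Lemma delta_term_lt n t : (2 <= n)%N -> (u n < t%:E)%E -> n%:R `^ (- t) < psi n.
Proof.
move=> n2; rewrite delta_termE //; case: ifPn => // p0.
have n1 : 1 < n%:R :> R by rewrite ltr1n.
have n0 : 0 < n%:R :> R by apply: lt_trans n1.
have pp : 0 < psi n by rewrite lt0r p0 psi_ge0.
rewrite lte_fin ltr_pdivrMr ?ln_gt0 // => h.
by rewrite -ltr_ln ?posrE ?powR_gt0 // ln_powR mulNr ltrNl.
Qed.

Lemma delta_term_gt n t : (2 <= n)%N -> (t%:E < u n)%E -> psi n <= n%:R `^ (- t).
Proof.
move=> n2; rewrite delta_termE //; case: ifPn => [/eqP -> _|p0]; first exact: powR_ge0.
have n1 : 1 < n%:R :> R by rewrite ltr1n.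
have n0 : 0 < n%:R :> R by apply: lt_trans n1.
have pp : 0 < psi n by rewrite lt0r p0 psi_ge0.
rewrite lte_fin ltr_pdivlMr ?ln_gt0 // => h.
by rewrite -ler_ln ?posrE ?powR_gt0 // ln_powR mulNr lerNr ltW.
Qed.

Lemma lt_delta_exp t : (t%:E < delta_exp psi)%E ->
  exists n0, forall n, (n0 <= n)%N -> psi n <= n%:R `^ (- t).
Proof.
rewrite /delta_exp limn_einf_lim (cvg_lim _ (cvg_einfs_sup (u := u))) //.
move=> /ereal_sup_gt[_ [n0 _ <-] h].
exists (maxn 2 n0) => n; rewrite geq_max => /andP[n2 nn0].
apply: delta_term_gt => //; apply: lt_le_trans h _.
by apply: ereal_inf_lbound; exists n.
Qed.

Lemma delta_exp_lt t : (delta_exp psi < t%:E)%E ->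
  forall n0, exists2 n, (n0 <= n)%N & n%:R `^ (- t) < psi n.
Proof.
rewrite /delta_exp limn_einf_lim (cvg_lim _ (cvg_einfs_sup (u := u))) // => h n0.
have : (einfs u (maxn 2 n0) < t%:E)%E.
  by apply: le_lt_trans h; apply: ereal_sup_ubound; exists (maxn 2 n0).
move=> /ereal_inf_lt[_ [n /= nge <-] hn].
move: nge; rewrite geq_max => /andP[n2 nn0].
by exists n => //; apply: delta_term_lt.
Qed.

End DeltaExponent.

(** * Sparse blocks of imposed digits *)

Section Blocks.
Context (k L : nat -> nat).
Context (kL : forall b, (b <= k b <= L b)%N).

(** After a block that ends at [L b], the next one is planned from position
    [b' = (L b).+1] on: positions from [b'] to [k b'] are free and those from
    [k b'] to [L b'] imposed. *)
Fixpoint block_start l := if l is l'.+1 then (L (block_start l')).+1 else 0%N.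
Local Notation e := block_start.

Definition in_block i := exists l, (k (e l) <= i <= L (e l))%N.

Lemma block_start_lt l : (e l < e l.+1)%N.
Proof. by rewrite /= ltnS; have /andP[] := kL (e l); apply: leq_trans. Qed.

Lemma leq_block_start : {homo e : a b / (a <= b)%N}.
Proof.
by apply: homo_leq => // [a b c|a]; [exact: leq_trans|rewrite ltnW ?block_start_lt].
Qed.

Lemma ltn_block_start : {homo e : a b / (a < b)%N}.
Proof. by apply: homo_ltn => [a b c|]; [exact: ltn_trans|exact: block_start_lt]. Qed.

Lemma before_block l i : (e l <= i < k (e l))%N -> ~ in_block i.
Proof.
move=> /andP[li ik] [l' /andP[kl' il']].
case: (ltnP l' l) => ll'.
  have := leq_block_start ll'; rewrite /= => h.
  by have := leq_trans h li; rewrite ltnNge il'.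
case: (ltngtP l l') => [lt|lt|eq].
- have /andP[h _] := kL (e l'); have := ltn_block_start lt.
  have /andP[_ h2] := kL (e l); have := leq_block_start lt => /= h3 h4.
  have := leq_trans h (leq_trans kl' (ltnW ik)).
  by move=> h5; have := leq_trans h3 h5; rewrite ltnNge h2.
- by rewrite ltnNge ll' in lt.
- by move: ik; rewrite eq ltnNge kl'.
Qed.

(** The free positions between [b] and [k b] alone make up a proportion [theta]
    of the positions up to the end of the block, whatever happened before [b]. *)
Lemma free_count_block (R : realType) (N : nat) (c : nat -> option 'I_N) (theta : R) :
  (forall i, c i = None <-> ~ in_block i) -> 0 <= theta <= 1 ->
  (forall b, theta * (L b).+1%:R <= (k b - b)%:R) ->
  forall i, theta * i%:R <= (free_count c i)%:R.
Proof.
move=> cN /andP[t0 t1] hL.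
have fr_free l i : (e l + i <= k (e l))%N -> free_count c (e l + i) = (free_count c (e l) + i)%N.
  elim: i => [|i IH] h; first by rewrite !addn0.
  rewrite addnS free_countS IH; last by rewrite ltnW // -addnS.
  have -> : c (e l + i)%N = None.
    by apply/cN; apply: (before_block (l := l)); rewrite leq_addr /= -addnS.
  by rewrite addn1 addnS.
have main l : forall i, (i <= e l)%N -> theta * i%:R <= (free_count c i)%:R.
  elim: l => [|l IH] i; first by rewrite leqn0 => /eqP ->; rewrite mulr0.
  have [il _|li] := leqP i (e l); first exact: IH.
  have /andP[ek kLe] := kL (e l).
  have [ik _|ki ie] := leqP i (k (e l)).
    have -> : free_count c i = (free_count c (e l) + (i - e l))%N.
      by rewrite -{1}(subnKC (ltnW li)) fr_free // subnKC // ltnW.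
    rewrite -{1}(subnKC (ltnW li)) !natrD mulrDr.
    by rewrite lerD ?IH // ler_piMl.
  apply: (@le_trans _ _ (k (e l) - e l)%:R).
    by apply: le_trans (hL _); rewrite ler_wpM2l // ler_nat.
  rewrite ler_nat; apply: leq_trans (leq_free_count c (ltnW ki)).
  by rewrite -{2}(subnKC ek) fr_free ?subnKC // leq_addl.
have gei l : (l <= e l)%N by elim: l => // l IH; apply: leq_ltn_trans IH (block_start_lt l).
by move=> i; apply: (main i).
Qed.

End Blocks.

(** * The lower bound *)

Section LowerBound.
Context (R : realType) (m : nat) (q : 'I_m -> nat) (p : 'I_m -> int).
Context (K : set R) (B : nat).
Context (hq : forall i, (2 <= q i)%N).
Context (hK : is_attractor q p K).
Context (hB : forall i, `|p i| <= B%:Z * ((q i)%:Z - 1)).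
Context (psi : nat -> R).
Context (psi_noninc : forall a b : nat, (a <= b)%N -> psi b <= psi a).

Lemma heights_words u v : v != [::] ->
  heights R q p (wmap q p u (wfix q p rat v)) (wq q u * (wq q v - 1))%N.
Proof.
case: v => // i v _; pose n := (size u + size v)%N.
have sz : size (u ++ i :: v) == n.+1 by rewrite size_cat /= addnS.
have un : (size u < n.+1)%N by rewrite ltnS leq_addr.
exists n, (Tuple sz), (Ordinal un).
rewrite word_seq_coding // word_heightE /= take_size_cat // drop_size_cat //.
by rewrite ratr_wmap ratr_wfix.
Qed.

(** Where to put one block: at a scale [n] with [psi n > n^-tau], the rational uses
    [k.+1] digits, so that its height is below [n], and the approximation must be
    exact up to about [tau * k] digits. Since [theta * tau < 1], a large [k] leaves
    enough free positions. *)
Lemma block_exists (Q : nat) (tau theta : R) : (2 <= Q)%N -> 1 <= tau ->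
  0 <= theta -> theta * tau < 1 ->
  (forall n0, exists2 n, (n0 <= n)%N & n%:R `^ (- tau) < psi n) ->
  forall b, exists k L n : nat, [/\ (b <= k <= L)%N,
    theta * L.+1%:R <= (k - b)%:R, (Q ^ k.+1 <= n)%N &
    (2 * B)%:R / Q%:R ^+ L <= psi n].
Proof.
move=> Q2 tau1 th0 tht large b.
have Q1 : 1 <= Q%:R :> R by rewrite ler1n ltnW.
have QR0 : 0 < Q%:R :> R by rewrite ltr0n ltnW.
(* [k >= x] is the condition that enough positions are free. *)
pose x : R := (b%:R + theta * (2 * tau + (2 * B + 2)%:R)) / (1 - theta * tau).
have [n nge npsi] := large (Q ^ (b + Num.bound `|x|).+2)%N.
pose k := (trunc_log Q n).-1.
have n0 : (0 < n)%N by apply: leq_trans nge; rewrite expn_gt0; lia.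
have hlog : ((b + Num.bound `|x|).+2 <= trunc_log Q n)%N by rewrite trunc_log_max.
have kE : trunc_log Q n = k.+1 by rewrite /k prednK //; apply: leq_trans hlog.
have kn : (Q ^ k.+1 <= n)%N by rewrite -kE trunc_logP.
have nk : (n < Q ^ k.+2)%N by have := trunc_log_ltn n Q2; rewrite kE.
have bk : (b + Num.bound `|x| <= k)%N by rewrite kE in hlog; lia.
(* [n < Q ^ k.+2] gives the term in [tau]; the term [2 * B] is there because
   [2 * B <= Q ^ (2 * B)]. *)
pose L := ((Num.trunc (tau * k.+2%:R)).+1 + 2 * B)%N.
have tk0 : 0 <= tau * k.+2%:R by rewrite mulr_ge0 // (le_trans ler01).
have /andP[Llo Lhi] := truncn_itv tk0.
exists k, L, n; split => //.
- apply/andP; split; first by apply: leq_trans bk; exact: leq_addr.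
  rewrite /L; apply: leq_trans (leq_addr _ _); rewrite -(ler_nat R).
  apply: le_trans (ltW Lhi); apply: (@le_trans _ _ k.+2%:R); first by rewrite ler_nat; lia.
  by rewrite ler_peMl.
- rewrite natrB; last by apply: leq_trans bk; exact: leq_addr.
  have xk : x <= k%:R - b%:R.
    rewrite lerBrDr; apply: (@le_trans _ _ (b + Num.bound `|x|)%:R); last by rewrite ler_nat.
    rewrite natrD addrC lerD2l (le_trans (ler_norm _)) // ltW //.
    exact: archi_boundP.
  have d0 : 0 < 1 - theta * tau by rewrite subr_gt0.
  have : (b%:R + theta * (2 * tau + (2 * B + 2)%:R)) <= k%:R * (1 - theta * tau).
    rewrite -ler_pdivrMr // (le_trans xk) // gerBl //.
  have : theta * L.+1%:R <= theta * (tau * k.+2%:R + (2 * B + 2)%:R).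
    have -> : L.+1 = (Num.trunc (tau * k.+2%:R) + (2 * B + 2))%N by rewrite /L; lia.
    by rewrite ler_wpM2l // natrD lerD2r.
  rewrite -[k.+2]addn2 natrD => h1 h2; apply: le_trans h1 _.
  have -> : theta * (tau * (k%:R + 2) + (2 * B + 2)%:R) =
    k%:R * (theta * tau) + theta * (2 * tau + (2 * B + 2)%:R) by ring.
  lra.
- apply: le_trans (ltW npsi); rewrite powRN.
  rewrite ler_pdivrMr ?exprn_gt0 // mulrC ler_pdivlMr ?powR_gt0 ?ltr0n //.
  apply: (@le_trans _ _ (Q%:R ^+ (2 * B) * Q%:R `^ (tau * k.+2%:R))).
    apply: ler_pM; rewrite ?powR_ge0 //.
      rewrite -natrX ler_nat; apply: ltnW; apply: ltn_expl; exact: Q2.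
    rewrite mulrC powRrM powR_mulrn ?(ltW QR0) // -natrX.
    apply: ge0_ler_powR; rewrite ?nnegrE ?ler0n ?(le_trans ler01 tau1) // ler_nat.
    exact: ltnW.
  rewrite /L exprD mulrC; apply: ler_wpM2r; first by rewrite exprn_ge0 ?ltW.
  rewrite -powR_mulrn ?(ltW QR0) //; apply: ler_powR => //; exact: ltW.
Qed.

(** The last position of each block carries another digit than the rest of the
    block, which makes the approximating rationals pairwise distinct: each of them
    repeats the digit of the block for ever, while the later ones follow the
    point through the end of the block. *)
Lemma E_int_dim_ge (s tau t : R) : ~ digits_le q p B s -> 0 < s -> 1 <= tau ->
  0 <= t -> t * tau < s ->
  (forall n0, exists2 n, (n0 <= n)%N & n%:R `^ (- tau) < psi n) ->
  (t%:E <= hausdorff_dim (E_int q p K psi))%E.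
Proof.
move=> nd s0 tau1 t0 tts large.
have [Q [N [W [Q2 WQ gap ltN]]]] := well_spaced_subsystem hq (ltW s0) nd.
have PB := subsystem_digit_bound WQ hB.
have Q1 : 1 < Q%:R :> R by rewrite ltr1n.
have QR0 : 0 < Q%:R :> R by apply: lt_trans Q1.
have N2 : (1 < N)%N.
  rewrite -(ltr_nat R); apply: le_lt_trans ltN.
  by rewrite -[X in X <= _](powRr0 Q%:R) ler_powR // ltW.
pose theta := t / s.
have th0 : 0 <= theta by rewrite divr_ge0 // ltW.
have tht : theta * tau < 1 by rewrite /theta mulrAC ltr_pdivrMr // mul1r.
have th1 : theta <= 1 by apply: ltW; apply: le_lt_trans tht; rewrite ler_peMr.
have /choice[k /choice[L /choice[n kLn]]] := block_exists Q2 tau1 th0 tht large.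
have kL b : (b <= k b <= L b)%N by have [] := kLn b.
pose e := block_start L.
pose d0 : 'I_N := Ordinal (ltnW N2); pose d1 : 'I_N := Ordinal N2.
pose c i := if `[< in_block k L i >]
  then Some (if `[< exists l, i = L (e l) >] then d1 else d0) else None.
have cN i : c i = None <-> ~ in_block k L i.
  by rewrite /c; case: asboolP.
have cin l i : (k (e l) <= i < L (e l))%N -> c i = Some d0.
  move=> /andP[ki iL]; rewrite /c; case: asboolP => [_|[]]; last by exists l; rewrite ki ltnW.
  case: asboolP => // -[l' il']; subst i.
  have h1 : (L (e l') < L (e l))%N by [].
  case: (ltngtP l l') => ll'.
  - have h2 := leq_block_start kL ll'; have /andP[h3 h4] := kL (e l').
    by have := leq_trans h2 (leq_trans h3 h4); rewrite /= ltnNge (ltnW h1).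
  - have h2 := leq_block_start kL ll'; have /andP[h3 h4] := kL (e l).
    by have := leq_trans h2 (leq_trans h3 ki); rewrite /= ltnn.
  - by move: h1; rewrite ll' ltnn.
have clast l : c (L (e l)) = Some d1.
  have /andP[_ kl] := kL (e l).
  rewrite /c; case: asboolP => [_|[]]; last by exists l; rewrite kl leqnn.
  by case: asboolP => // -[]; exists l.
apply: (@hausdorff_dim_digit_set R N Q _ B Q2 PB gap c _ t 1) => // [|i|j adj].
- exact: ltnW.
- rewrite mul1r powR_exprVn ?(ltW QR0) // lef_pV2 ?posrE ?exprn_gt0 ?powR_gt0 ?ltr0n ?(ltnW N2) ?(ltnW Q2) //.
  apply: (@le_trans _ _ ((Q%:R `^ s) ^+ free_count c i)).
    rewrite -!powR_mulrn ?powR_ge0 // -!powRrM; apply: ler_powR; first exact: ltW.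
    have := free_count_block kL cN _ (fun b => _) i (theta := theta).
    rewrite th0 th1 => /(_ isT) h; rewrite -[t](divfK (lt0r_neq0 s0)) -/theta mulrAC mulrC.
    by rewrite ler_pM2l // h // => b; have [] := kLn b.
  by rewrite lerXn2r ?nnegrE ?powR_ge0 // ltW.
split; first exact: (subsystem_attractor hq hK WQ Q2 hB).
pose jl l i := if (i < k (e l))%N then j i else d0.
pose r l : rat := wmap q p (flatten (map W (mkseq j (k (e l))))) (wfix q p rat (W d0)).
have W0 : W d0 != [::].
  by apply/eqP => h; move: Q2; rewrite -(WQ d0) h /wq big_nil.
pose y := digit_point R Q (fun a => wp q p (W a)).
have rE l : ratr (r l) = y (jl l).
  rewrite /r ratr_wmap ratr_wfix /y (digit_pointS R Q2 PB _ (k (e l))) wmap_subsystem //.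
  have -> : mkseq (jl l) (k (e l)) = mkseq j (k (e l)).
    by apply/eq_in_map => i; rewrite mem_iota /= add0n /jl => ->.
  congr wmap; symmetry; apply/wfixP => //.
  set z := digit_point _ _ _ _; rewrite [RHS](digit_pointS R Q2 PB _ 1).
  have -> : mkseq (fun t => jl l (k (e l) + t)%N) 1 = [:: d0].
    by rewrite /mkseq /= addn0 /jl ltnn.
  rewrite wmap_subsystem //= cats0; congr wmap; rewrite /z; congr digit_point.
  by apply/funext => i; rewrite /jl !ltnNge !leq_addr.
have agree l : mkseq j (L (e l)) = mkseq (jl l) (L (e l)).
  apply/eq_in_map => i; rewrite mem_iota /= add0n /jl => iL.
  by case: ltnP => // ki; apply: adj; apply: (cin l); rewrite ki.
apply: (@infinite_range _ _ r).
  move=> l l' rr; apply/eqP; apply: contrapT => /negP ll'.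
  wlog lt : l l' rr ll' / (l < l')%N.
    move=> H; case: (ltngtP l l') => h; [exact: (H l l')| |by rewrite h eqxx in ll'].
    by apply: (H l' l) => //; rewrite eq_sym.
  have yy : y (jl l) = y (jl l') by rewrite -!rE rr.
  have seqE : mkseq (jl l) (L (e l)).+1 = mkseq (jl l') (L (e l)).+1.
    apply: contrapT => /(digit_point_separated R Q2 PB gap).
    by rewrite -/y yy subrr normr0 leNgt invr_gt0 exprn_gt0.
  have := congr1 (fun x => nth d0 x (L (e l))) seqE; rewrite !nth_mkseq // /jl.
  have /andP[_ kl] := kL (e l); rewrite ltnNge kl /=.
  have -> : (L (e l) < k (e l'))%N.
    have /andP[h _] := kL (e l').
    by apply: leq_trans h; exact: (leq_block_start kL lt).
  by rewrite (adj _ _ (clast l)).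
move=> l /=; have [_ _ Qn psin] := kLn (e l).
have hr : heights R q p (r l) (Q ^ k (e l) * (Q - 1))%N.
  have := heights_words (flatten (map W (mkseq j (k (e l))))) W0.
  by rewrite (wq_subsystem WQ) size_mkseq WQ.
split; first by rewrite rE; exact: (subsystem_attractor hq hK WQ Q2 hB).
apply: le_trans (_ : psi (n (e l)) <= _); last first.
  apply: psi_noninc; have [_ hmin] := h_intP (ex_intro _ _ hr).
  apply: leq_trans (hmin _ hr) _; apply: leq_trans Qn.
  by rewrite expnS mulnC leq_mul2r leq_subr orbT.
apply: le_trans psin; rewrite rE.
exact: (digit_point_close R Q2 PB (agree l)).
Qed.

End LowerBound.

(** * The dimension formula *)

(* In \bar R, inversion satisfies (+oo)^-1 = 0. *)
Theorem theorem1p8 (R : realType) (m : nat) (q : 'I_m -> nat) (p : 'I_m -> int)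
  (K : set R) (psi : nat -> R)
  (hm : (2 <= m)%N) (hq : forall i, (2 <= q i)%N)
  (hK : is_attractor q p K)
  (psi_ge0 : forall n, 0 <= psi n)
  (psi_noninc : forall a b : nat, (a <= b)%N -> psi b <= psi a) :
  hausdorff_dim (E_int q p K psi) =
    (hausdorff_dim K / Order.max 1 (delta_exp psi))%E.
Proof.
pose B := (\sum_i absz (p i))%N.
have hB i : `|p i| <= B%:Z * ((q i)%:Z - 1).
  have : (absz (p i) <= B)%N by rewrite /B (bigD1 i) //= leq_addr.
  by have := hq i; nia.
have [d dK] : exists d : R, hausdorff_dim K = d%:E.
  by exists (fine (hausdorff_dim K)); rewrite fineK //; exact: (attractor_dim_fin hq hK hB).
have d0 : 0 <= d by rewrite -lee_fin -dK hausdorff_dim_ge0.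
have EK : (hausdorff_dim (E_int q p K psi) <= d%:E)%E.
  by rewrite -dK; apply: hausdorff_dimS => x [].
(* [(d + s) / 2] is an exponent strictly between [dim K = d] and [s]. *)
have upper sigma s : 0 < sigma -> (sigma%:E < delta_exp psi)%E -> d < s ->
    (hausdorff_dim (E_int q p K psi) <= (s / sigma)%:E)%E.
  move=> sigma0 lt ds; have [n0 hn0] := lt_delta_exp psi_ge0 lt.
  have hd : digits_le q p B ((d + s) / 2).
    apply: contrapT => /(attractor_dim_ge hq hK hB); rewrite dK lee_fin; lra.
  apply: (@E_int_dim_le R m q p K B hq hK psi ((d + s) / 2) s sigma
            (1 + psi 0%N * n0%:R `^ sigma)) => //; [lra|lra| |].
    by rewrite addr_ge0 // mulr_ge0 // powR_ge0.
  move=> n n_gt0; rewrite mulrDl mul1r.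
  have nR : 0 < n%:R :> R by rewrite ltr0n.
  have [nn0|nn0] := leqP n0 n.
    by rewrite (le_trans (hn0 n nn0)) // lerDl !mulr_ge0 ?powR_ge0.
  apply: (@le_trans _ _ (psi 0%N * n0%:R `^ sigma * n%:R `^ (- sigma))).
    rewrite -mulrA (le_trans (psi_noninc 0%N n _)) // ler_peMr //.
    rewrite powRN ler_pdivlMr ?powR_gt0 // mul1r.
    by apply: ge0_ler_powR; rewrite ?nnegrE ?(ltW sigma0) // ler_nat ltnW.
  by rewrite lerDr powR_ge0.
have lower tau t : 1 <= tau -> (delta_exp psi < tau%:E)%E -> 0 <= t -> t * tau < d ->
    (t%:E <= hausdorff_dim (E_int q p K psi))%E.
  move=> tau1 dt t0 ttd; have ttau0 : 0 <= t * tau by rewrite mulr_ge0 // (le_trans ler01).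
  pose s' := (t * tau + d) / 2.
  apply: (@E_int_dim_ge R m q p K B hq hK hB psi psi_noninc s' tau t) => //; rewrite /s'; [|lra|lra|].
    move=> hd.
    have h : (hausdorff_dim K <= ((s' + d) / 2)%:E)%E.
      by apply: (attractor_dim_le hq hK _ hd); rewrite /s'; lra.
    by move: h; rewrite dK lee_fin /s'; lra.
  exact: delta_exp_lt.
have divdiv (x y : R) : x != 0 -> y = x / (x / y).
  by move=> x0; rewrite invf_div mulrCA divff // mulr1.
rewrite dK.
have [dy|dNy] := eqVneq (delta_exp psi) +oo%E.
  rewrite dy maxEle leey invey mule0.
  apply/eqP; rewrite eq_le hausdorff_dim_ge0 andbT.
  apply/lee_addgt0Pr => e e0; rewrite add0e.
  rewrite [e](divdiv (d + 1)); last by rewrite gt_eqF // ltr_wpDl.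
  by apply: upper; [rewrite divr_gt0 // ltr_wpDl|rewrite dy ltry|rewrite ltrDl].
have [D [D1 maxE dD Dor]] : exists D : R, [/\ 1 <= D, Order.max 1%E (delta_exp psi) = D%:E,
    (delta_exp psi <= D%:E)%E & D = 1 \/ delta_exp psi = D%:E].
  have [d1|d1] := leP (delta_exp psi) 1%E; first by exists 1; split => //; left.
  have fin : delta_exp psi \is a fin_num.
    by rewrite fin_numE dNy andbT; apply/eqP => h; rewrite h in d1.
  exists (fine (delta_exp psi)); rewrite fineK //; split => //; last by right.
  by rewrite -lee_fin fineK // ltW.
have D0 : 0 < D by apply: lt_le_trans D1.
rewrite maxE inver gt_eqF // -EFinM; apply/eqP; rewrite eq_le; apply/andP; split.
  case: Dor => [->|dE]; first by rewrite divr1.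
  apply/lee_addgt0Pr => e e0; rewrite -EFinD.
  have De : 0 < D * e by rewrite mulr_gt0.
  have den : 0 < d / D + e by rewrite ltr_wpDl // divr_ge0 // ltW.
  have num : 0 < d + D * e / 2 by lra.
  rewrite [d / D + e](divdiv (d + D * e / 2)) ?gt_eqF //.
  apply: upper; first exact: divr_gt0.
    rewrite dE lte_fin ltr_pdivrMr // mulrDr mulrCA divff ?gt_eqF // mulr1; lra.
  lra.
apply/lee_addgt0Pr => e e0.
have De : 0 < D * e by rewrite mulr_gt0.
have dDD : d / D * D = d by rewrite divfK // gt_eqF.
have [t0|t0] := leP (d / D - e) 0.
  apply: (@le_trans _ _ e%:E); first by rewrite lee_fin; lra.
  by rewrite leeDr // hausdorff_dim_ge0.
have -> : (d / D)%:E = ((d / D - e)%:E + e%:E)%E by rewrite -EFinD subrK.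
apply: leeD2r; set t := d / D - e.
have tD : t * D = d - D * e by rewrite /t mulrBl dDD mulrC.
apply: (lower (D + D * e / 2 / t)) => //.
- by rewrite (le_trans D1) // lerDl !divr_ge0 // ltW.
- by apply: le_lt_trans dD _; rewrite lte_fin ltrDl divr_gt0 // divr_gt0.
- exact: ltW.
- rewrite mulrDr tD mulrCA divff ?gt_eqF // mulr1; lra.
Qed.
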